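(* Let $R$ be an artin algebra, $\mathcal{A}=\mathrm{mod}(R)$, and let $\mathcal{C}\subseteq\mathcal{A}$ be a full additive, strictly full, Karoubi closed subcategory which is functorially finite. Then $\mathcal{H}_{\mathcal{C}}$ has enough injectives. They are of the form $\mathbb{S}_{\mathcal{C}}\mathsf{P}_C$ for $C\in\mathcal{C}$. In particular, each injective in $\mathcal{H}_{\mathcal{C}}$ is the $\mathcal{C}$-approximation of some injective in $\mathcal{H}_{\mathcal{A}}$.
   Context: $R$ is finite over its center $k$, a commutative artinian ring; $\mathrm{mod}(R)$ is the category of finitely generated left $R$-modules; $\mathbb{D}=\mathrm{Hom}_k(-,E)$ with $E$ the injective hull of $k/\mathrm{rad}(k)$ as $k$-module. Strictly full means closed under isomorphisms; Karoubi closed means closed under direct summands in $\mathcal{A}$. $\mathcal{T}_{\mathcal{C}}=K^-(\mathcal{C})$ (bounded above cochain complexes modulo homotopy) is a full triangulated subcategory of $\mathcal{T}_{\mathcal{A}}=K^-(\mathcal{A})$. A $\mathcal{C}$-approximation of $X\in\mathcal{T}_{\mathcal{A}}$ is a quasi-isomorphism $X_{\mathcal{C}}\to X$ with $X_{\mathcal{C}}\in\mathcal{T}_{\mathcal{C}}$ inducing an isomorphism $\mathrm{Hom}_{\mathcal{T}_{\mathcal{C}}}(-,X_{\mathcal{C}})\to\mathrm{Hom}_{\mathcal{T}_{\mathcal{A}}}(-,X)|_{\mathcal{T}_{\mathcal{C}}}$. $\mathcal{C}$ is $\mathcal{A}$-approximating if every $X\in\mathcal{T}_{\mathcal{A}}$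 has a $\mathcal{C}$-approximation (equivalently, every $M\in\mathcal{A}$ has a $\mathcal{C}$-cover: a surjection $C\to M$ with $C\in\mathcal{C}$ through which every map $C'\to M$, $C'\in\mathcal{C}$, factors); then $\pi_{\mathcal{C}}X=X_{\mathcal{C}}$ defines a functor $\pi_{\mathcal{C}}:\mathcal{T}_{\mathcal{A}}\to\mathcal{T}_{\mathcal{C}}$ right adjoint to the inclusion. $\mathcal{C}$ is functorially finite if $\mathcal{C}$ is $\mathcal{A}$-approximating and $\mathcal{C}^{op}$ is $\mathcal{A}^{op}$-approximating. $\mathcal{H}_{\mathcal{A}}$ is the abelian category of complexes $[X^{-2}\to X^{-1}\to X^0]$ in $\mathcal{A}$ with no cohomology in negative degrees, morphisms modulo homotopy. $\mathcal{T}^{\leq 0}_{\mathcal{C}}$ is the strictly full subcategory of $\mathcal{T}_{\mathcal{C}}$ generated by complexes with $X^i=0$ for $i>0$; it is the $\leq 0$ part of a $t$-structure with $\mathcal{T}^{\geq 0}_{\mathcal{C}}=\{X\mid\mathrm{Hom}_{\mathcal{T}_{\mathcal{C}}}(\mathcal{T}^{\leq 0}_{\mathcal{C}}[1],X)=0\}$, and $\mathcal{H}_{\mathcal{C}}$ is its heart, an abelian category; $\pi_{\mathcal{C}}(\mathcal{H}_{\mathcal{A}})=\mathcal{H}_{\mathcal{C}}$. $\mathsf{P}_M$ is the complex with $M$ in degree $0$; $M\mapsto\mathsf{P}_M$ gives equivalences $\mathcal{A}\cong\mathrm{Proj}(\mathcal{H}_{\mathcal{A}})$ and $\mathcal{C}\cong\mathrm{Proj}(\mathcal{H}_{\mathcal{C}})$.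 For $M\in\mathcal{A}$, $\mathbb{S}_{\mathcal{A}}\mathsf{P}_M$ is the unique injective object of $\mathcal{H}_{\mathcal{A}}$ with $\mathbb{D}\,\mathrm{Hom}_{\mathcal{H}_{\mathcal{A}}}(\mathsf{P}_M,-)\cong\mathrm{Hom}_{\mathcal{H}_{\mathcal{A}}}(-,\mathbb{S}_{\mathcal{A}}\mathsf{P}_M)$ (this gives an equivalence $\mathrm{Proj}(\mathcal{H}_{\mathcal{A}})\cong\mathrm{Inj}(\mathcal{H}_{\mathcal{A}})$), and $\mathbb{S}_{\mathcal{C}}\mathsf{P}_C:=\pi_{\mathcal{C}}(\mathbb{S}_{\mathcal{A}}\mathsf{P}_C)$ for $C\in\mathcal{C}$. *)

(* Defs.v *)
From HB Require Import structures.
From mathcomp Require Import all_boot all_order all_algebra.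
From Stdlib Require Import ClassicalEpsilon.

Set Implicit Arguments.
Unset Strict Implicit.
Unset Printing Implicit Defensive.

Import Order.TTheory GRing.Theory Num.Theory.
Local Open Scope ring_scope.

(** * Artin algebras and their dualizing modules *)

Definition is_submodule (k : pzRingType) (M : lmodType k) (U : M -> Prop) : Prop :=
  U 0 /\ (forall a x y, U x -> U y -> U (a *: x + y)).

Definition is_ideal (k : comPzRingType) (I : k -> Prop) : Prop :=
  @is_submodule k k^o I.

Definition artinian (k : comPzRingType) : Prop :=
  forall I : nat -> k -> Prop,
    (forall n, is_ideal (I n)) ->
    (forall n a, I n.+1 a -> I n a) ->
    exists N, forall n, (N <= n)%N -> forall a, I N a -> I n a.

Definition is_maximal_ideal (k : comPzRingType) (m : k -> Prop) : Prop :=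
  [/\ is_ideal m, ~ m 1 &
      forall I : k -> Prop, is_ideal I -> ~ I 1 ->
        (forall a, m a -> I a) -> forall a, I a -> m a].

Definition jacobson_radical (k : comPzRingType) (a : k) : Prop :=
  forall m : k -> Prop, is_maximal_ideal m -> m a.

Definition finitely_generated (R : pzRingType) (M : lmodType R) : Prop :=
  exists (n : nat) (g : 'I_n -> M),
    forall x, exists c : 'I_n -> R, x = \sum_(i < n) c i *: g i.

(* [a |-> a%:A] identifies [k] with the center of [R]; that its image is
   central is already part of [algType]. *)
Definition is_center (k : comPzRingType) (R : algType k) : Prop :=
  injective (fun a : k => a%:A : R) /\
  forall z : R, (forall x, z * x = x * z) -> exists a : k, z = a%:A.

Definition artin_algebra (k : comPzRingType) (R : algType k) : Prop :=
  [/\ is_center R, artinian k & finitely_generated (R : lmodType k)].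

Definition injective_module (k : pzRingType) (E : lmodType k) : Prop :=
  forall (M N : lmodType k) (i : {linear M -> N}) (f : {linear M -> E}),
    injective i -> exists g : {linear N -> E}, forall x, g (i x) = f x.

Definition is_injective_hull (k : pzRingType) (M E : lmodType k)
    (j : {linear M -> E}) : Prop :=
  [/\ injective_module E, injective j &
      forall U : E -> Prop, is_submodule U ->
        (forall m, U (j m) -> j m = 0) -> forall x, U x -> x = 0].

(* [E] is an injective hull of [k / rad k]; the quotient is given by a
   surjection [p : k -> Q] with kernel [rad k]. *)
Definition is_dualizing_module (k : comPzRingType) (E : lmodType k) : Prop :=
  exists (Q : lmodType k) (p : {linear k^o -> Q}) (j : {linear Q -> E}),
    [/\ forall y, exists a, p a = y,
        forall a, p a = 0 <-> jacobson_radical (a : k) &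
        is_injective_hull j].

(** * Cochain complexes of modules and homotopy *)

Record complex (R : pzRingType) := Complex {
  cob :> int -> lmodType R;
  cdiff : forall i, {linear cob i -> cob (i + 1)};
  cdiffK : forall i x, cdiff (i + 1) (cdiff i x) = 0 }.

Arguments cdiff {R} X i : rename.

Record cmap (R : pzRingType) (X Y : complex R) := CMap {
  cmor :> forall i, {linear X i -> Y i};
  cmorE : forall i x, cmor (i + 1) (cdiff X i x) = cdiff Y i (cmor i x) }.

Section ChainMaps.

Context {R : pzRingType}.
Implicit Types X Y Z : complex R.

Lemma cidE X i (x : X i) : idfun (cdiff X i x) = cdiff X i (idfun x).
Proof. by []. Qed.

Definition cid X : cmap X X := @CMap R X X (fun i => idfun) (@cidE X).

Lemma ccompE X Y Z (g : cmap Y Z) (f : cmap X Y) i (x : X i) :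
  (g (i + 1) \o f (i + 1)) (cdiff X i x) = cdiff Z i ((g i \o f i) x).
Proof. by rewrite /= !cmorE. Qed.

Definition ccomp X Y Z (g : cmap Y Z) (f : cmap X Y) : cmap X Z :=
  @CMap R X Z (fun i => g i \o f i) (@ccompE X Y Z g f).

Lemma czeroE X Y i (x : X i) :
  (\0 : {linear X (i + 1) -> Y (i + 1)}) (cdiff X i x)
  = cdiff Y i ((\0 : {linear X i -> Y i}) x).
Proof. by rewrite /= linear0. Qed.

Definition czero X Y : cmap X Y := @CMap R X Y (fun i => \0) (@czeroE X Y).

(* Since [i] runs over all integers, so does [i + 1]: this is
   f - g = d h + h d in every degree. *)
Definition homotopic X Y (f g : cmap X Y) : Prop :=
  exists h : forall i, {linear X (i + 1) -> Y i},
    forall i x,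
      f (i + 1) x - g (i + 1) x
      = cdiff Y i (h i x) + h (i + 1) (cdiff X (i + 1) x).

Definition homotopy_equivalent X Y : Prop :=
  exists (f : cmap X Y) (g : cmap Y X),
    homotopic (ccomp g f) (cid X) /\ homotopic (ccomp f g) (cid Y).

Lemma shift_diffK X i (x : X (i + 1)) :
  (\- cdiff X (i + 1 + 1)) ((\- cdiff X (i + 1)) x) = 0.
Proof. by rewrite /= linearN opprK cdiffK. Qed.

Definition shift X : complex R :=
  @Complex R (fun i => X (i + 1)) (fun i => \- cdiff X (i + 1)) (@shift_diffK X).

Definition zero_module : lmodType R := 'rV[R]_0.

Definition stalk_ob (M : lmodType R) (i : int) : lmodType R :=
  if i is Posz 0 then M else zero_module.

Lemma stalk_diffK (M : lmodType R) i (x : stalk_ob M i) :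
  (\0 : {linear stalk_ob M (i + 1) -> stalk_ob M (i + 1 + 1)})
    ((\0 : {linear stalk_ob M i -> stalk_ob M (i + 1)}) x) = 0.
Proof. by []. Qed.

(* The complex P_M, with [M] in degree 0. *)
Definition stalk (M : lmodType R) : complex R :=
  @Complex R (stalk_ob M) (fun i => \0) (@stalk_diffK M).

Definition zero_at X (i : int) : Prop := forall x : X i, x = 0.

Definition bounded_above X : Prop := exists n, forall i, n < i -> zero_at X i.

Definition bounded_below X : Prop := exists n, forall i, i < n -> zero_at X i.

(* Vanishing of the cohomology in degree [i + 1]. *)
Definition exact_at_succ X (i : int) : Prop :=
  forall x : X (i + 1), cdiff X (i + 1) x = 0 -> exists y, cdiff X i y = x.

(* Injectivity and surjectivity of the map induced on each H^(i+1). *)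
Definition quasi_iso X Y (f : cmap X Y) : Prop :=
  forall i,
    (forall x : X (i + 1), cdiff X (i + 1) x = 0 ->
       (exists y, cdiff Y i y = f (i + 1) x) -> exists x', cdiff X i x' = x) /\
    (forall y : Y (i + 1), cdiff Y (i + 1) y = 0 ->
       exists2 x : X (i + 1), cdiff X (i + 1) x = 0 &
         exists y', y - f (i + 1) x = cdiff Y i y').

(** * Full subcategories of the homotopy category

    A full subcategory is given by a predicate on complexes; its morphisms are
    chain maps, and [homotopic] is equality of morphisms. *)

Definition mono_in (P : complex R -> Prop) X Y (f : cmap X Y) : Prop :=
  forall Z (g h : cmap Z X), P Z ->
    homotopic (ccomp f g) (ccomp f h) -> homotopic g h.

Definition injective_in (P : complex R -> Prop) (I : complex R) : Prop :=
  P I /\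
  forall X Y (f : cmap X Y) (u : cmap X I), P X -> P Y -> mono_in P f ->
    exists v : cmap Y I, homotopic (ccomp v f) u.

Definition enough_injectives (P : complex R -> Prop) : Prop :=
  forall X, P X -> exists (I : complex R) (f : cmap X I),
    injective_in P I /\ mono_in P f.

(** * Subcategories of mod(R) and approximations *)

Implicit Types C : lmodType R -> Prop.

Definition strictly_full C : Prop :=
  forall (M N : lmodType R) (f : {linear M -> N}), bijective f -> C M -> C N.

Definition additive_subcat C : Prop :=
  C zero_module /\ forall M N : lmodType R, C M -> C N -> C (M * N)%type.

Definition karoubi_closed C : Prop :=
  forall M N : lmodType R, finitely_generated M -> finitely_generated N ->
    C (M * N)%type -> C M.

(* K^-(C) and K^+(C). *)
Definition Kminus C X : Prop := (forall i, C (X i)) /\ bounded_above X.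

Definition Kplus C X : Prop := (forall i, C (X i)) /\ bounded_below X.

Definition is_approximation C Y X (q : cmap Y X) : Prop :=
  [/\ Kminus C Y, quasi_iso q &
      forall Z, Kminus C Z ->
        (forall f g : cmap Z Y,
           homotopic (ccomp q f) (ccomp q g) -> homotopic f g) /\
        (forall g : cmap Z X, exists f : cmap Z Y, homotopic (ccomp q f) g)].

Definition is_coapproximation C X Y (q : cmap X Y) : Prop :=
  [/\ Kplus C Y, quasi_iso q &
      forall Z, Kplus C Z ->
        (forall f g : cmap Y Z,
           homotopic (ccomp f q) (ccomp g q) -> homotopic f g) /\
        (forall g : cmap X Z, exists f : cmap Y Z, homotopic (ccomp f q) g)].

Definition approximating C : Prop :=
  forall X, Kminus (@finitely_generated R) X ->
    exists (Y : complex R) (q : cmap Y X), is_approximation C q.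

(* [C^op] is [mod(R)^op]-approximating, read through the identification of
   K^-(B^op) with the opposite of K^+(B) given by X^i <-> X^(-i). *)
Definition coapproximating C : Prop :=
  forall X, Kplus (@finitely_generated R) X ->
    exists (Y : complex R) (q : cmap X Y), is_coapproximation C q.

Definition functorially_finite C : Prop := approximating C /\ coapproximating C.

(* The object part of the functor pi_C. *)
Definition pi C X : complex R :=
  epsilon (inhabits (stalk zero_module))
    (fun Y => exists q : cmap Y X, is_approximation C q).

(** * The categories H_A and H_C *)

Definition heartA X : Prop :=
  [/\ forall i, finitely_generated (X i),
      forall i, i < - 2%:Z \/ 0 < i -> zero_at X i &
      forall i : int, i + 1 < 0 -> exact_at_succ X i].

Definition Tle0 C X : Prop :=
  Kminus C X /\
  exists Y, [/\ Kminus C Y, forall i, 0 < i -> zero_at Y i &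
                homotopy_equivalent X Y].

Definition Tge0 C X : Prop :=
  Kminus C X /\
  forall Y (f : cmap (shift Y) X), Tle0 C Y -> homotopic f (czero (shift Y) X).

Definition heart C X : Prop := Tle0 C X /\ Tge0 C X.

End ChainMaps.

(** * The objects S_A P_M and S_C P_M *)

Section Serre.

Context {k : comPzRingType} {R : algType k}.
Implicit Types X Y S : complex R.

Definition clin_fun (M N : lmodType R) (a : k) (f g : M -> N) : M -> N :=
  fun x => a%:A *: f x + g x.

Lemma clin_is_linear (M N : lmodType R) a (f g : {linear M -> N}) :
  linear (clin_fun a f g).
Proof.
move=> c x y; rewrite /clin_fun !linearP /= !scalerDr !scalerA.
by rewrite -scalerAl -scalerAr mul1r mulr1 addrACA.
Qed.

HB.instance Definition _ (M N : lmodType R) a (f g : {linear M -> N}) :=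
  GRing.isLinear.Build R M N *:%R (clin_fun a f g) (clin_is_linear a f g).

Lemma clinE X Y (a : k) (f g : cmap X Y) i (x : X i) :
  clin_fun a (f (i + 1)) (g (i + 1)) (cdiff X i x)
  = cdiff Y i (clin_fun a (f i) (g i) x).
Proof. by rewrite /clin_fun !cmorE linearP. Qed.

(* The [k]-linear combination a f + g. *)
Definition clin X Y (a : k) (f g : cmap X Y) : cmap X Y :=
  @CMap R X Y (fun i => clin_fun a (f i) (g i)) (@clinE X Y a f g).

(* [phi] is an element of the dual Hom_k(Hom(X, Y), E), where Hom(X, Y) is the
   [k]-module of chain maps modulo homotopy. *)
Definition in_dual_hom (E : lmodType k) X Y (phi : cmap X Y -> E) : Prop :=
  (forall f g, homotopic f g -> phi f = phi g) /\
  (forall a f g, phi (clin a f g) = a *: phi f + phi g).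

(* A natural [k]-linear isomorphism Hom(-, S) -> D Hom(P_M, -) of functors
   on H_A. *)
Definition is_serre_iso (E : lmodType k) (M : lmodType R) S
    (theta : forall X, cmap X S -> cmap (stalk M) X -> E) : Prop :=
  (forall X, heartA X ->
     [/\ forall f, in_dual_hom (theta X f),
         forall a f g u,
           theta X (clin a f g) u = a *: theta X f u + theta X g u,
         forall f g, homotopic f g <-> (forall u, theta X f u = theta X g u) &
         forall phi, in_dual_hom phi ->
           exists f, forall u, theta X f u = phi u]) /\
  (forall X Y (v : cmap X Y) (f : cmap Y S) (u : cmap (stalk M) X),
     heartA X -> heartA Y -> theta X (ccomp f v) u = theta Y f (ccomp v u)).

Definition is_serre_object (E : lmodType k) (M : lmodType R) S : Prop :=
  injective_in heartA S /\
  exists theta : forall X, cmap X S -> cmap (stalk M) X -> E,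
    is_serre_iso theta.

Definition serreA (E : lmodType k) (M : lmodType R) : complex R :=
  epsilon (inhabits (stalk zero_module)) (is_serre_object E M).

Definition serreC (E : lmodType k) (C : lmodType R -> Prop) (M : lmodType R) :
    complex R :=
  pi C (serreA E M).

End Serre.

(* Main.v *)
(** By Matlis duality over the artinian ring [k], the functor [D] is an exact
    duality on finitely generated [k]-modules.  If [R^m -> R^n -> M] is a
    presentation with matrix [A], the complex [ker -> D(R^m) -> D(R^n)] induced
    by [A] represents [D Hom(P_M, -)] on all complexes in degrees [<= 0]; hence it
    is [S_A P_M], and its [C]-approximation represents [D Hom(P_M, -)] on [H_C].
    Injectivity follows because [P_M] is projective and [D] is exact.

    Every [X] in [H_C] embeds in such an object: the pushout of
    [X^0 <- X^-1 -> D(R^m)] embeds in some [D(R^n)], so that [X^-1] becomes a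
    pullback of [D(R^m) -> D(R^n) <- X^0]; this map is given by a matrix, which
    presents a module [N], and a left [C]-approximation [N -> M] replaces [N] by
    an object of [C].  Finally, biduality for [End(M)] makes [M |-> S_C P_M] fully
    faithful, so an injective, being a retract of some [S_C P_M], comes from an
    idempotent of [M], which splits in [C]. *)

From HB Require Import structures.
From mathcomp Require Import all_boot all_order all_algebra ring.
From mathcomp Require Import boolp classical_sets functions.
Require Import Defs.

Set Implicit Arguments.
Unset Strict Implicit.
Unset Printing Implicit Defensive.

Import Order.TTheory GRing.Theory Num.Theory.
Local Open Scope ring_scope.
Local Open Scope classical_set_scope.

(** * Linear maps and submodules *)

Section LinearMaps.

Context {R : pzRingType}.
Implicit Types M N : lmodType R.

(** [k] is artinian only in the sense of descending chains of ideals, and [E] is only an injective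
    hull of [k / rad k]. The finiteness of duals, reflexivity and Noetherianity of finitely
    generated modules are therefore derived here, by one descent through simple subquotients
    [k / m].

    The representability statements rest on one formula. If [M] has generators [g_i] and relations
    [A], then [Hom(M, X)] is the kernel of [A : X^n -> X^m], while a map [X -> D(R^n)] is an
    [n]-tuple of functionals on [X]. Applying the tuple of functionals to the tuple [u(g_i)] pairs
    the two, and exactness of duality makes [D Hom(M, X)] the cokernel of
    [Hom(X, D(R^m)) -> Hom(X, D(R^n))].

    Objects of [H_C] may be unbounded to the left, whereas the definition of [serreA] tests [H_A]
    only and picks the object by [epsilon]. Its behaviour on [H_C] becomes accessible once Yoneda on
    [H_A] has identified it with the explicit complex. *)

Definition mklin M N (f : M -> N) (hf : linear f) : {linear M -> N} :=
  HB.pack f (GRing.isLinear.Build R M N *:%R f hf).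

End LinearMaps.

Lemma submod_zero (R : pzRingType) (M : lmodType R) : is_submodule (fun x : M => x = 0).
Proof. by split=> // a x y -> ->; rewrite scaler0 addr0. Qed.

Section Submodules.

Context {R : pzRingType} {M : lmodType R}.
Implicit Types (U : M -> Prop).

Lemma submod0 U : is_submodule U -> U 0.
Proof. by case. Qed.

Lemma submodD U x y : is_submodule U -> U x -> U y -> U (x + y).
Proof. by case=> _ h Ux Uy; rewrite -[x]scale1r; exact: h. Qed.

Lemma submodZ U a x : is_submodule U -> U x -> U (a *: x).
Proof. by case=> U0 h Ux; rewrite -[_ *: _]addr0; exact: h. Qed.

Lemma submodN U x : is_submodule U -> U x -> U (- x).
Proof. by move=> h Ux; rewrite -scaleN1r; exact: submodZ. Qed.

Lemma submodB U x y : is_submodule U -> U x -> U y -> U (x - y).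
Proof. by move=> h Ux Uy; apply: submodD => //; exact: submodN. Qed.

Lemma submod_sum U (I : finType) (F : I -> M) :
  is_submodule U -> (forall i, U (F i)) -> U (\sum_i F i).
Proof.
by move=> h hF; apply: big_ind => //; [exact: submod0 | move=> x y; exact: submodD].
Qed.

Definition sub_pred U (h : is_submodule U) : {pred M} := fun x => `[< U x >].

Section SubType.

Context U (hU : is_submodule U).

Fact sub_pred_closed : GRing.subsemimod_closed (sub_pred hU).
Proof.
split; first split; first (by apply/asboolP; exact: submod0).
  by move=> x y /asboolP Ux /asboolP Uy; apply/asboolP; exact: submodD.
by move=> a x /asboolP Ux; apply/asboolP; exact: submodZ.
Qed.

HB.instance Definition _ :=
  GRing.isSubmodClosed.Build R M (sub_pred hU) sub_pred_closed.

(** A submodule given by a predicate becomes an [lmodType], so that kernels, images and truncated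
    terms can be terms of complexes. *)
Record sub := Sub_ { sub_val : M; sub_valP : sub_pred hU sub_val }.

HB.instance Definition _ := [isSub of sub for sub_val].
HB.instance Definition _ := [Choice of sub by <:].
HB.instance Definition _ := [SubChoice_isSubLmodule of sub by <:].

Lemma sub_valK (x : sub) : U (sub_val x).
Proof. by case: x => x /= /asboolP. Qed.

Definition insub_ x (Ux : U x) : sub := Sub_ (asboolT Ux : sub_pred hU x).

Lemma sub_val_inj : injective sub_val.
Proof. exact: val_inj. Qed.

Lemma sub_val_linear : linear sub_val.
Proof. move=> a x y; exact: (linearP (val : sub -> M)). Qed.

Definition sub_incl : {linear sub -> M} := mklin sub_val_linear.

Section Corestriction.

Context (N : lmodType R) (f : {linear N -> M}) (hf : forall x, U (f x)).

Lemma corestr_linear : linear (fun x => insub_ (hf x)).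
Proof.
move=> a x y; apply: sub_val_inj.
by rewrite sub_val_linear /= linearP.
Qed.

Definition corestr : {linear N -> sub} := mklin corestr_linear.

End Corestriction.

End SubType.

(** For an ideal [A] this is [U + A g]. Shrinking [A] lets the chain condition on ideals act on
    submodules of [M]. *)
Definition adjoin U (A : R -> Prop) g (x : M) : Prop :=
  exists a u, [/\ A a, U u & x = u + a *: g].

Lemma adjoin_sub U (A : R -> Prop) g x : A 0 -> U x -> adjoin U A g x.
Proof. by move=> A0 Ux; exists 0, x; split; rewrite ?scale0r ?addr0. Qed.

Lemma submod_ker (N : lmodType R) (f : {linear M -> N}) :
  is_submodule (fun x => f x = 0).
Proof.
split=> [|a x y fx fy]; first exact: linear0.
by rewrite linearP fx fy scaler0 addr0.
Qed.

Lemma submod_im (N : lmodType R) (f : {linear N -> M}) :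
  is_submodule (fun x => exists y, x = f y).
Proof.
split=> [|a _ _ [x ->] [y ->]]; first by exists 0; rewrite linear0.
by exists (a *: x + y); rewrite linearP.
Qed.

End Submodules.

(** * Artinian commutative rings *)

Section Ideals.

Context {k : comPzRingType}.
Implicit Types (A B L m : k -> Prop).

Lemma idl0 A : is_ideal A -> A 0. Proof. by case. Qed.

Lemma idlD A x y : is_ideal A -> A x -> A y -> A (x + y).
Proof. exact: (@submodD k k^o). Qed.

Lemma idlM A a x : is_ideal A -> A x -> A (a * x).
Proof. exact: (@submodZ k k^o). Qed.

Lemma idlB A x y : is_ideal A -> A x -> A y -> A (x - y).
Proof. exact: (@submodB k k^o). Qed.

Lemma ideal_principal b : is_ideal (fun y : k => exists a, y = a * b).
Proof.
split=> [|c _ _ [a ->] [a' ->]]; first by exists 0; rewrite mul0r.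
by exists (c * a + a'); rewrite mulrDl -mulrA.
Qed.

Lemma ideal_colon A b : is_ideal A -> is_ideal (fun a => A (a * b)).
Proof.
move=> hA; split=> [|c x y Ax Ay]; first by rewrite mul0r; exact: idl0.
rewrite /= -[c *: x]/(c * x) mulrDl -mulrA.
by apply: idlD => //; exact: idlM.
Qed.

Lemma ideal_annihilator (V : lmodType k) (U : V -> Prop) v :
  is_submodule U -> is_ideal (fun a : k => U (a *: v)).
Proof.
move=> hU; split=> [|c x y Ux Uy]; first by rewrite scale0r; exact: submod0.
rewrite /= -[c *: x]/(c * x) scalerDl -scalerA.
by apply: submodD => //; exact: submodZ.
Qed.

Lemma idealI A B : is_ideal A -> is_ideal B -> is_ideal (fun a => A a /\ B a).
Proof.
case=> A0 hA [B0 hB]; split=> // a x y [Ax Bx] [Ay By].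
by split; [exact: hA | exact: hB].
Qed.

Lemma maximal_ideal m : is_maximal_ideal m -> is_ideal m.
Proof. by case. Qed.

Lemma maximal_inv m a : is_maximal_ideal m -> ~ m a -> exists c, m (1 - c * a).
Proof.
case=> hm m1 mmax nma.
pose I x := exists c y, m y /\ x = c * a + y.
have hI : is_ideal I.
  split=> [|b _ _ [c [y [my ->]]] [c' [y' [my' ->]]]].
    by exists 0, 0; split; [exact: idl0 | rewrite mul0r addr0].
  exists (b * c + c'), (b * y + y'); split; first exact: (hm.2 b).
  by rewrite -[b *: _]/(b * _); ring.
have [[c [y [my e]]]|nI1] := EM (I 1).
  by exists c; rewrite e addrC addKr.
case: nma; apply: (mmax I hI nI1).
  by move=> x mx; exists 0, x; split=> //; rewrite mul0r add0r.
by exists 1, 0; split; [exact: idl0 | rewrite mul1r addr0].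
Qed.

(** The product ideal [m A], as the intersection of all ideals containing the products; this avoids
    finite sums. *)
Definition ideal_mul m A (x : k) : Prop :=
  forall L, is_ideal L -> (forall a y, m a -> A y -> L (a * y)) -> L x.

Lemma ideal_ideal_mul m A : is_ideal (ideal_mul m A).
Proof.
split=> [L hL _|a x y hx hy L hL h]; first exact: idl0.
by apply: (hL.2 a); [exact: hx | exact: hy].
Qed.

Hypothesis hk : artinian k.

(** Without a minimal member, choice would iterate strict descents into an infinite chain. *)
Lemma artinian_min (P : (k -> Prop) -> Prop) I0 :
  is_ideal I0 -> P I0 ->
  exists I, [/\ is_ideal I, P I &
    forall J, is_ideal J -> P J -> (forall a, J a -> I a) ->
      forall a, I a -> J a].
Proof.
move=> hI0 PI0; apply: contrapT => nomin.
pose T := {I : k -> Prop | is_ideal I /\ P I}.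
have step (s : T) : exists t : T,
    (forall a, sval t a -> sval s a) /\ ~ forall a, sval s a -> sval t a.
  case: s => I [hI PI]; apply: contrapT => no; apply: nomin.
  exists I; split=> // J hJ PJ JI a Ia; apply: contrapT => nJa.
  apply: no; exists (exist _ J (conj hJ PJ)); split=> // h.
  by apply: nJa; exact: h.
have [next nextP] := choice step.
pose s n := iter n next (exist _ I0 (conj hI0 PI0) : T).
have [|n a|N hN] := hk (I := fun n => sval (s n)).
- by move=> n; case: (svalP (s n)).
- exact: (nextP (s n)).1.
by case: (nextP (s N)) => _; apply; exact: (hN N.+1).
Qed.

(* If [B] is minimal among the ideals not contained in [A] and [b] lies in [B]
   but not in [A], then [(kb + A)/A] is simple, with annihilator [(A : b)]. *)
Lemma maximal_over A : is_ideal A -> ~ A 1 ->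
  exists m, is_maximal_ideal m /\ forall a, A a -> m a.
Proof.
move=> hA nA1.
have [|B [hB [b [Bb nAb]] minB]] :=
  @artinian_min (fun I => exists x, I x /\ ~ A x) (fun _ => True) ltac:(by []).
  by exists 1.
exists (fun a => A (a * b)); split; last first.
  by move=> a Aa; rewrite mulrC; exact: idlM.
split; [exact: ideal_colon | by rewrite mul1r |].
move=> I hI nI1 mI a Ia; apply: contrapT => nAab.
have [c e] : exists c, b = c * (a * b).
  apply: (minB _ (ideal_principal (a * b)) _ _ b Bb).
    by exists (a * b); split=> //; exists 1; rewrite mul1r.
  by move=> x [c ->]; rewrite mulrA; exact: idlM.
apply: nI1; rewrite -(subrK (c * a) 1); apply: idlD => //; last exact: idlM.
by apply: mI; rewrite mulrBl mul1r -mulrA -e subrr; exact: idl0.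
Qed.

(** Take [L] minimal among the ideals containing some [x] congruent to 1 modulo [m]. For a maximal
    ideal [m'], either [L] meets [m'] outside [m], and minimality puts [L] inside [m'], or [m']
    equals [m]. In both cases [m x] lies in [m'], so the class of [x] in [k / rad k] is nonzero and
    killed by [m]. *)
Lemma radical_socle m : is_maximal_ideal m ->
  exists x, ~ m x /\ forall a, m a -> jacobson_radical (a * x).
Proof.
move=> hm; have [im nm1 mmax] := hm.
have [|L [hL [x [Lx m1x]] minL]] :=
  @artinian_min (fun I => exists x, I x /\ m (1 - x)) (fun _ => True)
    ltac:(by []).
  by exists 1; split=> //; rewrite subrr; exact: idl0.
exists x; split=> [mx|a ma m' hm'].
  by apply: nm1; rewrite -(subrK x 1); exact: idlD.
have im' := maximal_ideal hm'.
have [sub|] := EM (forall y, L y -> m' y -> m y); last first.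
  move=> /existsNP[y /not_implyP[Ly /not_implyP[m'y nmy]]].
  have [c mc] := maximal_inv hm nmy.
  apply: idlM => //.
  suff /(_ x Lx) [] : forall a, L a -> L a /\ m' a by [].
  apply: minL; [exact: idealI | | by move=> ? []].
  by exists (c * y); do 2?split=> //; exact: idlM.
(* Both [z (1 - x)] and [z x] lie in [m]: the first as [1 - x] does, the second as it lies in [L]
   and [m']. *)
have m'm z : m' z -> m z.
  move=> m'z; rewrite -[z](subrK (z * x)); apply: idlD => //.
    by rewrite -{1}[z]mulr1 -mulrBr; exact: idlM.
  by apply: sub; [exact: idlM | rewrite mulrC; exact: idlM].
rewrite mulrC; apply: idlM => //.
by case: hm' => _ _ /(_ m im nm1 m'm); exact.
Qed.

(* Take [L = kx] minimal with [A L <> 0] and a maximal ideal [m] over the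
   annihilator of [x]: then [m x = L], so [x = a x] with [a] in [m]. *)
Lemma artinian_nakayama A : is_ideal A ->
  (forall m, is_maximal_ideal m -> forall a, A a -> ideal_mul m A a) ->
  forall a, A a -> a = 0.
Proof.
move=> hA hmA a Aa; apply: contrapT => na0.
have [|L [hL [x [y [Lx Ay nyx]]] minL]] :=
  @artinian_min (fun I => exists x y, [/\ I x, A y & y * x <> 0])
    (fun _ => True) ltac:(by []).
  by exists 1, a; split=> //; rewrite mulr1.
pose N z := z * x = 0.
have hN : is_ideal N.
  split=> [|c z z' Nz Nz']; first by rewrite /N mul0r.
  by rewrite /N -[c *: z]/(c * z) mulrDl -mulrA Nz Nz' mulr0 addr0.
have [|m [hm Nm]] := maximal_over hN.
  by rewrite /N mul1r => x0; apply: nyx; rewrite x0 mulr0.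
have [im nm1 _] := hm.
have hmx : is_ideal (fun z => exists b, m b /\ z = b * x).
  split=> [|c _ _ [b [mb ->]] [b' [mb' ->]]].
    by exists 0; split; [exact: idl0 | rewrite mul0r].
  exists (c * b + b'); split; first exact: (im.2 c).
  by rewrite -[c *: _]/(c * _); ring.
have [b [mb e]] : exists b, m b /\ x = b * x.
  apply: (minL _ hmx _ _ x Lx) => [|_ [b [_ ->]]]; last exact: idlM.
  apply: contrapT => no.
  apply: nyx; apply: (hmA m hm y Ay (fun y => y * x = 0) hN) => c z mc Az.
  apply: contrapT => ncz; apply: no; exists (c * x), z; split=> //.
    by exists c.
  by rewrite mulrCA mulrA.
apply: nm1; rewrite -(subrK b 1); apply: idlD => //.
by apply: Nm; rewrite /N mulrBl mul1r -e subrr.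
Qed.

End Ideals.

(** * Matlis duality *)

Section Matlis.

Context {k : comPzRingType} {E : lmodType k}.
Hypotheses (hk : artinian k) (hE : is_dualizing_module E).

(** The [m]-torsion of [E] has dimension at most one over [k / m]. A nonzero element killed by [m]
    spans a simple submodule, which meets the image of [k / rad k] by essentialness. So both
    elements come from [k / rad k], and the representative [x0] of [e0] is invertible modulo [m]. *)
Lemma socle_gen (m : k -> Prop) (e e0 : E) : is_maximal_ideal m -> e0 <> 0 ->
  (forall a, m a -> a *: e0 = 0) -> (forall a, m a -> a *: e = 0) ->
  exists c : k, e = c *: e0.
Proof.
move=> hm e0n0 me0 me; have im := maximal_ideal hm.
case: hE => Q [p [j [p_surj p_ker [_ j_inj ess]]]].
have inQ e1 : e1 <> 0 -> (forall a, m a -> a *: e1 = 0) ->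
    exists x : k, e1 = j (p x).
  move=> e1n0 me1.
  have : ~ forall q, (exists a : k, j q = a *: e1) -> j q = 0.
    move=> no; apply: e1n0.
    apply: (ess (fun x => exists a : k, x = a *: e1)) => //; last first.
      by exists 1; rewrite scale1r.
    split=> [|c _ _ [a ->] [b ->]]; first by exists 0; rewrite scale0r.
    by exists (c * a + b); rewrite scalerDl scalerA.
  move=> /existsNP[q /not_implyP[[a ea] jq0]].
  have nma : ~ m a by move=> ma; apply: jq0; rewrite ea me1.
  have [c mc] := maximal_inv hm nma.
  have [y ey] := p_surj q.
  exists (c * y).
  rewrite -[c * y]/(c *: (y : k^o)) linearZ ey linearZ /= ea scalerA.
  by apply/eqP; rewrite -subr_eq0 -[X in X - _]scale1r -scalerBl me1.
have [->|e_n0] := EM (e = 0); first by exists 0; rewrite scale0r.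
have [x0 ex0] := inQ _ e0n0 me0; have [x ex] := inQ _ e_n0 me.
have radm y e1 : e1 = j (p y) -> (forall a, m a -> a *: e1 = 0) ->
    forall a, m a -> jacobson_radical (a * y).
  move=> ey me1 a ma; apply/p_ker; apply: j_inj.
  by rewrite -[a * y]/(a *: (y : k^o)) linearZ linearZ /= -ey me1 // linear0.
have nrad : ~ jacobson_radical x0.
  by move=> /p_ker px0; apply: e0n0; rewrite ex0 px0 linear0.
have [m' [hm' nm'x0]] : exists m', is_maximal_ideal m' /\ ~ m' x0.
  by move: nrad => /existsNP[m' /not_implyP[]]; exists m'.
have mm' a : m a -> m' a.
  move=> ma; apply: contrapT => nm'a.
  have [c m'c] := maximal_inv hm' nm'a; have im' := maximal_ideal hm'.
  apply: nm'x0; rewrite -[x0](subrK (c * a * x0)); apply: idlD => //.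
    by rewrite -[X in X - _]mul1r -mulrBl mulrC; exact: idlM.
  by rewrite -mulrA; apply: idlM => //; exact: radm ex0 me0 a ma m' hm'.
have nmx0 : ~ m x0 by move=> /mm'.
have [c mc] := maximal_inv hm nmx0.
exists (x * c).
rewrite ex0 -linearZ -linearZ ex /= -[_ *: _]/(x * c * x0).
congr (j _); apply/eqP; rewrite -subr_eq0 -linearB; apply/eqP/p_ker => /=.
have -> : (x : k) - x * c * x0 = (1 - c * x0) * x by ring.
exact: radm ex me _ mc.
Qed.

(** Each simple module [k / m] already embeds in [k / rad k]; this makes [E] a cogenerator. *)
Lemma socle_neq0 (m : k -> Prop) : is_maximal_ideal m ->
  exists e : E, e <> 0 /\ forall a, m a -> a *: e = 0.
Proof.
move=> hm; case: hE => Q [p [j [p_surj p_ker [_ j_inj ess]]]].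
have [x [nmx mx]] := radical_socle hk hm.
exists (j (p x)); split.
  rewrite -(linear0 j) => /j_inj /p_ker radx.
  by apply: nmx; exact: radx.
move=> a ma; rewrite -!linearZ /=.
by have /p_ker -> := mx a ma; exact: linear0.
Qed.

(** [phi] is a bare function, linear on [U] only, so functionals defined by choosing representatives
    can be extended directly. *)
Lemma extend_functional (V : lmodType k) (U : V -> Prop) (phi : V -> E) :
  is_submodule U ->
  (forall a x y, U x -> U y -> phi (a *: x + y) = a *: phi x + phi y) ->
  exists h : {linear V -> E}, forall x, U x -> h x = phi x.
Proof.
move=> hU hphi; case: hE => Q [p [j [_ _ [inj _ _]]]].
have lphi : linear (fun x : sub hU => phi (sub_incl hU x)).
  by move=> a x y; rewrite linearP hphi //; exact: sub_valK.
have [h hh] := inj _ _ (sub_incl hU) (mklin lphi) (@sub_val_inj _ _ _ hU).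
by exists h => x Ux; rewrite (hh (insub_ hU Ux)).
Qed.

Lemma factor_functional (V W : lmodType k) (T : {linear V -> W})
    (f : {linear V -> E}) :
  (forall x, T x = 0 -> f x = 0) ->
  exists h : {linear W -> E}, forall x, f x = h (T x).
Proof.
move=> hT.
pose phi w := f (xget 0 [set x | w = T x]).
have phiE x : phi (T x) = f x.
  rewrite /phi; case: xgetP => [y _ e|/(_ x) []] //.
  by apply/eqP; rewrite -subr_eq0 -linearB hT // linearB -e subrr.
have [|h hh] := @extend_functional _ _ phi (submod_im T).
  by move=> a _ _ [x ->] [y ->]; rewrite -linearP !phiE linearP.
by exists h => x; rewrite hh ?phiE //; exists x.
Qed.

(** On [U + k v], sending [u + a v] to [a e] is well defined exactly because [e] is killed by the
    annihilator of [v] modulo [U]. *)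
Lemma extend_cyclic (V : lmodType k) (U : V -> Prop) v (e : E) :
  is_submodule U -> (forall a, U (a *: v) -> a *: e = 0) ->
  exists f : {linear V -> E}, (forall u, U u -> f u = 0) /\ f v = e.
Proof.
move=> hU hv.
pose W x := exists a, U (x - a *: v).
have hW : is_submodule W.
  split=> [|a x y [b Ub] [c Uc]]; first by exists 0; rewrite scale0r subr0; exact: submod0.
  exists (a * b + c).
  have -> : a *: x + y - (a * b + c) *: v = a *: (x - b *: v) + (y - c *: v).
    by rewrite scalerDl scalerBr scalerA opprD addrACA.
  exact: (hU.2 a).
pose phi x := xget 0 [set a | U (x - a *: v)] *: e.
have phiE x a : U (x - a *: v) -> phi x = a *: e.
  rewrite /phi; case: xgetP => [b _ Ub Ua|/(_ a)] //.
  apply/eqP; rewrite -subr_eq0 -scalerBl hv // scalerBl.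
  have -> : b *: v - a *: v = (x - a *: v) - (x - b *: v).
    by rewrite opprB [RHS]addrC addrA subrK.
  exact: submodB.
have [|f hf] := @extend_functional _ W phi hW.
  move=> a x y [b Ub] [c Uc]; rewrite (phiE _ _ Ub) (phiE _ _ Uc) scalerA -scalerDl.
  apply: phiE.
  have -> : a *: x + y - (a * b + c) *: v = a *: (x - b *: v) + (y - c *: v).
    by rewrite scalerDl scalerBr scalerA opprD addrACA.
  exact: (hU.2 a).
exists f; split=> [u Uu|].
  have Uu0 : U (u - 0 *: v) by rewrite scale0r subr0.
  by rewrite hf; [rewrite (phiE _ _ Uu0) scale0r | exists 0].
have Uv1 : U (v - 1 *: v) by rewrite scale1r subrr; exact: submod0.
by rewrite hf; [rewrite (phiE _ _ Uv1) scale1r | exists 1].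
Qed.

(** Send [v] to a nonzero element of [E] killed by a maximal ideal over the annihilator of [v]
    modulo [U]. *)
Lemma separate (V : lmodType k) (U : V -> Prop) v :
  is_submodule U -> ~ U v ->
  exists f : {linear V -> E}, (forall u, U u -> f u = 0) /\ f v <> 0.
Proof.
move=> hU nUv.
have [|m [hm Am]] := maximal_over hk (ideal_annihilator v hU).
  by rewrite scale1r.
have [e [en0 me]] := socle_neq0 hm.
have [a /Am|f [fU fv]] := @extend_cyclic V U v e hU; first exact: me.
by exists f; split=> //; rewrite fv.
Qed.

(** Nakayama gives [x] in [A] outside [m A]. A functional killing [m A] but not [x] maps [A] onto
    the one-dimensional [m]-torsion of [E], and its kernel in [A] is [A']; no basis of [A / m A] has
    to be chosen. *)
Lemma simple_quotient (A : k -> Prop) : is_ideal A -> (exists a, A a /\ a <> 0) ->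
  exists m x A', [/\ is_maximal_ideal m, is_ideal A' /\ (forall a, A' a -> A a),
    A x /\ ~ A' x, forall a, m a -> A' (a * x) &
    forall y, A y -> exists c z, A' z /\ y = z + c * x].
Proof.
move=> hA [a0 [Aa0 a0n0]].
have [m [hm [x [Ax nmAx]]]] : exists m, is_maximal_ideal m /\
    exists x, A x /\ ~ ideal_mul m A x.
  apply: contrapT => no; apply: a0n0; apply: (artinian_nakayama hk hA) => //.
  move=> m hm a Aa; apply: contrapT => na; apply: no.
  by exists m; split=> //; exists a.
have [im nm1 mmax] := hm.
have hmA := @ideal_ideal_mul k m A.
have [e [en0 me]] := socle_neq0 hm.
have [a mAax|l [lU lx]] := @extend_cyclic k^o (ideal_mul m A) x e hmA.
  apply: me; apply: mmax (ideal_colon x hmA) _ _ _ mAax; first by rewrite mul1r.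
  by move=> b mb L hL; exact.
have ml a y : m a -> A y -> a *: l y = 0.
  by move=> ma Ay; rewrite -linearZ lU // => L hL; exact.
exists m, x, (fun a => A a /\ l a = 0); split=> //.
- by split=> [|a []//]; apply: idealI => //; exact: submod_ker.
- by split=> // -[_]; rewrite lx.
- move=> a ma; split; first exact: idlM.
  by rewrite -[a * x]/(a *: (x : k^o)) linearZ /= ml.
move=> y Ay.
have [a ma|c ec] := @socle_gen m (l y) e hm en0 me; first exact: ml.
exists c, (y - c * x); rewrite subrK; split=> //; split.
  by apply: idlB => //; exact: idlM.
by rewrite linearB -[c * x]/(c *: (x : k^o)) linearZ /= lx ec subrr.
Qed.

(* The three finiteness properties of [V/U] that are needed: its dual is
   finitely generated, it is reflexive (only the surjectivity of the map to the
   bidual is recorded), and it is noetherian. *)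
Record matlis_reflexive (V : lmodType k) (U : V -> Prop) : Prop := MatlisReflexive {
  dual_fg : exists n (f : 'I_n -> {linear V -> E}),
    (forall i u, U u -> f i u = 0) /\
    forall g : {linear V -> E}, (forall u, U u -> g u = 0) ->
      exists c : 'I_n -> k, forall v, g v = \sum_i c i *: f i v;
  bidual_surj : forall Phi : {linear V -> E} -> E,
    (forall a (f g h : {linear V -> E}),
       (forall u, U u -> f u = 0) -> (forall u, U u -> g u = 0) ->
       (forall v, h v = a *: f v + g v) -> Phi h = a *: Phi f + Phi g) ->
    exists v, forall f : {linear V -> E}, (forall u, U u -> f u = 0) -> Phi f = f v;
  noetherian_over : forall W : V -> Prop, is_submodule W ->
    (forall u, U u -> W u) ->
    exists n (w : 'I_n -> V), (forall i, W (w i)) /\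
      forall x, W x -> exists (c : 'I_n -> k) u, U u /\ x = u + \sum_i c i *: w i }.

Lemma matlis_reflexiveT (V : lmodType k) : @matlis_reflexive V (fun=> True).
Proof.
split=> [|Phi hPhi|W hW _].
- exists 0, (fun _ => \0); split=> // g g0.
  by exists (fun=> 0) => v; rewrite big_ord0 g0.
- exists 0 => f f0; rewrite f0 //.
  have := hPhi 1 f f f f0 f0; rewrite scale1r => h.
  have /h /eqP : forall v, f v = 1 *: f v + f v by move=> v; rewrite f0 // scaler0 addr0.
  by rewrite -subr_eq0 opprD addNKr oppr_eq0 => /eqP.
exists 0, (fun=> 0); split=> [_|x _]; first exact: submod0.
by exists (fun=> 0), x; rewrite big_ord0 addr0.
Qed.

(** The three properties pass from [V/U] to its extension [V/U'] by a module [U/U'] that is spanned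
    by [v0] and killed by [m]. Functionals killing [U'] take values at [v0] in a single line of [E],
    so one extra functional [f0] accounts for all new ones. *)
Lemma matlis_reflexive_simple (V : lmodType k) (U U' : V -> Prop) m v0 :
  is_submodule U -> is_submodule U' -> is_maximal_ideal m ->
  (forall x, U' x -> U x) -> U v0 ->
  (forall x, U x -> exists c u, U' u /\ x = u + c *: v0) ->
  (forall a, m a -> U' (a *: v0)) ->
  matlis_reflexive U -> matlis_reflexive U'.
Proof.
move=> hU hU' hm U'U Uv0 Ugen mv0 [[n [fs [fsU fsgen]]] Ubi Unoeth].
have [f0 [f0U' f0v0]] : exists f0 : {linear V -> E}, (forall u, U' u -> f0 u = 0) /\
    forall f : {linear V -> E}, (forall u, U' u -> f u = 0) ->
      exists c : k, f v0 = c *: f0 v0.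
  have [[f0 [f0U' f0n0]]|no] :=
    EM (exists f : {linear V -> E}, (forall u, U' u -> f u = 0) /\ f v0 <> 0).
    exists f0; split=> // f fU'; apply: (socle_gen hm f0n0) => a ma.
      by rewrite -linearZ f0U' //; exact: mv0.
    by rewrite -linearZ fU' //; exact: mv0.
  exists \0; split=> // f fU'; exists 0; rewrite scaler0.
  by apply: contrapT => fv0; apply: no; exists f.
have subU (f : {linear V -> E}) c : (forall u, U' u -> f u = 0) ->
    f v0 = c *: f0 v0 -> exists g : {linear V -> E},
      (forall v, g v = f v - c *: f0 v) /\ forall u, U u -> g u = 0.
  move=> fU' fc.
  have lg : linear (fun v => f v - c *: f0 v).
    move=> a x y; rewrite (linearP f) (linearP f0) /= scalerBr scalerDr !scalerA.
    by rewrite [c * a]mulrC opprD addrACA.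
  exists (mklin lg); split=> // u /Ugen[b [u' [U'u' ->]]] /=.
  rewrite (linearD f) (linearD f0) fU' // f0U' // !add0r (linearZ_LR f) (linearZ_LR f0).
  by rewrite fc !scalerA mulrC subrr.
split.
- exists n.+1, (fun i => if unlift ord_max i is Some j then fs j else f0).
  split=> [i u U'u|f fU'].
    by case: unlift => [j|]; [exact/fsU/U'U | exact: f0U'].
  have [c fc] := f0v0 f fU'; have [g [gE gU]] := subU f c fU' fc.
  have [d dE] := fsgen g gU.
  exists (fun i => if unlift ord_max i is Some j then d j else c) => v.
  rewrite big_ord_recr /= unlift_none -[LHS](subrK (c *: f0 v)) -gE dE.
  congr (_ + _); apply: eq_bigr => i _.
  by have -> : widen_ord (leqnSn n) i = lift ord_max i; [
    apply: val_inj; rewrite /= /bump leqNgt ltn_ord | rewrite liftK].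
- move=> Phi hPhi.
  (* [v] represents [Phi] on the functionals killing [U]. These kill [v0] too, so a multiple of [v0]
     may be added to correct the value at [f0]. *)
  have [|v vE] := Ubi Phi.
    by move=> a f g h fU gU; apply: hPhi => u /U'U; [exact: fU | exact: gU].
  have [c cE] : exists c : k, Phi f0 - f0 v = c *: f0 v0.
    have [f0v00|f0n0] := EM (f0 v0 = 0).
      exists 0; rewrite scale0r vE ?subrr // => u /Ugen[b [u' [U'u' ->]]].
      by rewrite linearD linearZ /= f0v00 f0U' // scaler0 addr0.
    apply: (socle_gen hm f0n0) => a ma; first by rewrite -linearZ f0U' //; exact: mv0.
    have lg : linear (fun v => a *: f0 v).
      by move=> b x y; rewrite linearP /= scalerDr !scalerA mulrC.
    have gU u : U u -> mklin lg u = 0.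
      move=> /Ugen[b [u' [U'u' ->]]] /=.
      rewrite linearD linearZ /= f0U' // add0r scalerA mulrC -scalerA.
      by rewrite -[a *: _]linearZ f0U' ?scaler0 //; exact: mv0.
    have e0 : Phi \0 = 0 by rewrite vE.
    have := hPhi a f0 \0 (mklin lg) f0U'.
    rewrite e0 addr0 vE //= => h; rewrite scalerBr -h ?subrr // => w.
    by rewrite /= addr0.
  exists (v + c *: v0) => f fU'.
  have [d fd] := f0v0 f fU'; have [g [gE gU]] := subU f d fU' fd.
  rewrite (hPhi d f0 g) //; last 2 first.
  - by move=> u /U'U /gU.
  - by move=> w; rewrite gE addrC subrK.
  rewrite (vE g) // gE (linearD f) (linearZ_LR f) fd !scalerA [c * d]mulrC -!scalerA -cE scalerBr.
  by rewrite addrCA.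
move=> W hW U'W.
(* The hypothesis over [U] is applied to [W + U]; the generators are then changed by elements of [U]
   so as to lie in [W]. *)
have [||n' [w' [Ww' w'gen]]] :=
    Unoeth (fun x => exists w u, [/\ W w, U u & x = u + w]).
- split=> [|a _ _ [w [u [Ww Uu ->]]] [w' [u' [Ww' Uu' ->]]]].
    by exists 0, 0; rewrite addr0; split=> //; exact: submod0.
  exists (a *: w + w'), (a *: u + u'); split; [exact: hW.2|exact: hU.2|].
  by rewrite scalerDr addrACA.
- by move=> u Uu; exists 0, u; rewrite addr0; split=> //; exact: submod0.
have [w ww'] := choice Ww'; have [u uw] := choice ww'.
have Wgen x : W x -> exists (c : 'I_n' -> k) y, U y /\ x = y + \sum_i c i *: w i.
  move=> Wx.
  have [|c [y [Uy ->]]] := w'gen x.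
    by exists x, 0; rewrite add0r; split=> //; exact: submod0.
  exists c, (y + \sum_i c i *: u i); split.
    apply: submodD => //; apply: submod_sum => // i; apply: submodZ => //.
    by case: (uw i).
  rewrite -addrA -big_split; congr (_ + _); apply: eq_bigr => i _.
  by have [_ _ ->] := uw i; rewrite scalerDr.
have Ww i : W (w i) by case: (uw i).
(* If [W] meets [U] only inside [U'], the lifted generators suffice; otherwise one more generator
   [w0] is added. *)
have [[w0 [Ww0 Uw0 nU'w0]]|no] := EM (exists w0, [/\ W w0, U w0 & ~ U' w0]); last first.
  exists n', w; split=> // x Wx; have [c [y [Uy e]]] := Wgen x Wx.
  exists c, y; split=> //; apply: contrapT => nU'y; apply: no; exists y; split=> //.
  have -> : y = x - \sum_i c i *: w i by rewrite e addrK.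
  by apply: submodB => //; apply: submod_sum => // i; exact: submodZ.
exists n'.+1, (fun i => if unlift ord_max i is Some j then w j else w0).
split=> [i|x Wx]; first by case: unlift.
have [c [y [Uy e]]] := Wgen x Wx.
have [a [u0 [U'u0 e0]]] := Ugen w0 Uw0.
have [b [u1 [U'u1 e1]]] := Ugen y Uy.
have nma : ~ m a.
  by move=> /mv0 h; apply: nU'w0; rewrite e0; exact: submodD.
(* Modulo [U'], [w0] is [a v0] with [a] invertible modulo [m], hence [b v0] is [b d w0]. *)
have [d md] := maximal_inv hm nma.
exists (fun i => if unlift ord_max i is Some j then c j else b * d).
exists (u1 + (b * (1 - d * a)) *: v0 - (b * d) *: u0); split.
  apply: submodB; [done| |exact: submodZ].
  by apply: submodD => //; rewrite -scalerA; apply: submodZ => //; exact: mv0.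
rewrite big_ord_recr /= unlift_none.
have -> : \sum_(i < n') (if unlift ord_max (widen_ord (leqnSn n') i) is Some j
     then c j else b * d) *: (if unlift ord_max (widen_ord (leqnSn n') i) is Some j
     then w j else w0) = \sum_i c i *: w i.
  apply: eq_bigr => i _.
  by have -> : widen_ord (leqnSn n') i = lift ord_max i; [
    apply: val_inj; rewrite /= /bump leqNgt ltn_ord | rewrite liftK].
rewrite e e1 e0 [LHS]addrC [RHS]addrCA; congr (_ + _).
rewrite [in RHS]scalerDr scalerA addrA subrK -addrA -scalerDl.
by congr (_ + _ *: _); ring.
Qed.

(** Choose [A] minimal with [V / (U + A g)] reflexive. Were [A] nonzero, a subideal [A'] with
    [A / A'] simple would contradict minimality; so [A = 0]. *)
Lemma matlis_reflexive_adjoin (V : lmodType k) (U : V -> Prop) g : is_submodule U ->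
  matlis_reflexive (adjoin U (fun=> True) g) -> matlis_reflexive U.
Proof.
move=> hU hT.
have submod_adj A : is_ideal A -> is_submodule (adjoin U A g).
  move=> hA; split=> [|a _ _ [b [u [Ab Uu ->]]] [b' [u' [Ab' Uu' ->]]]].
    by exists 0, 0; rewrite scale0r addr0; split=> //; [exact: idl0 | exact: submod0].
  exists (a * b + b'), (a *: u + u'); split; [exact: (hA.2 a)|exact: hU.2|].
  by rewrite scalerDr scalerDl scalerA addrACA.
have [//|A [hA rA minA]] :=
  artinian_min hk (P := fun A => matlis_reflexive (adjoin U A g)) _ hT.
have [A0|] := EM (forall a, A a -> a = 0).
  congr matlis_reflexive : rA; apply/funext => x; apply/propext; split.
    by case=> a [u [/A0 -> Uu ->]]; rewrite scale0r addr0.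
  by apply: adjoin_sub; exact: idl0.
move=> /existsNP[a0 /not_implyP an0].
have [|m [x [A' [hm [hA' A'A] [Ax nA'x] mx Agen]]]] := simple_quotient hA.
  by exists a0.
case: nA'x; apply: (minA A' hA' _ A'A x Ax).
apply: (@matlis_reflexive_simple _ (adjoin U A g) _ m (x *: g)) rA => //.
- exact: submod_adj.
- exact: submod_adj.
- by move=> _ [a [u [A'a Uu ->]]]; exists a, u; split=> //; exact: A'A.
- by exists x, 0; rewrite add0r; split=> //; exact: submod0.
- move=> _ [a [u [/Agen[c [z [A'z ->]]] Uu ->]]].
  exists c, (u + z *: g); split; first by exists z, u.
  by rewrite scalerDl scalerA addrA.
move=> a ma; exists (a * x), 0; rewrite add0r scalerA; split=> //; first exact: mx.
exact: submod0.
Qed.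

(** Induction on the number of generators of [V] modulo [U]: the last generator is absorbed into
    [U], then removed again by [matlis_reflexive_adjoin]. *)
Theorem fg_matlis_reflexive (V : lmodType k) (U : V -> Prop) :
  finitely_generated V -> is_submodule U -> matlis_reflexive U.
Proof.
case=> n [g gP] hU.
have {gP} : forall x, exists (c : 'I_n -> k) u, U u /\ x = u + \sum_i c i *: g i.
  by move=> x; have [c ->] := gP x; exists c, 0; rewrite add0r; split=> //; exact: submod0.
elim: n => [|n IHn] in g U hU *.
  move=> h; congr matlis_reflexive : (@matlis_reflexiveT V).
  apply/funext => x; apply/propext; split=> // _.
  by have [c [u [Uu ->]]] := h x; rewrite big_ord0 addr0.
move=> h; apply: (@matlis_reflexive_adjoin V U (g ord_max) hU).
apply: (IHn (fun i => g (widen_ord (leqnSn n) i))) => [|x].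
  split=> [|a _ _ [b [u [_ Uu ->]]] [b' [u' [_ Uu' ->]]]].
    by exists 0, 0; rewrite scale0r addr0; split=> //; exact: submod0.
  exists (a * b + b'), (a *: u + u'); split=> //; first exact: hU.2.
  by rewrite scalerDr scalerDl scalerA addrACA.
have [c [u [Uu ->]]] := h x.
exists (fun i => c (widen_ord (leqnSn n) i)), (u + c ord_max *: g ord_max).
split; first by exists (c ord_max), u.
by rewrite big_ord_recr /= addrA addrAC.
Qed.

End Matlis.

(** * Finitely generated modules *)

Section FinitelyGenerated.

Context {R : pzRingType}.
Implicit Types M N : lmodType R.

Lemma fg_finType M (I : finType) (g : I -> M) :
  (forall x, exists c : I -> R, x = \sum_i c i *: g i) -> finitely_generated M.
Proof.
move=> gP; exists #|I|, (fun i => g (enum_val i)) => x.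
have [c ->] := gP x; exists (fun i => c (enum_val i)).
by rewrite (reindex _ (onW_bij _ (@enum_val_bij I))).
Qed.

Lemma fg_surj M N (f : {linear M -> N}) :
  (forall y, exists x, f x = y) -> finitely_generated M -> finitely_generated N.
Proof.
move=> f_surj [n [g gP]]; exists n, (fun i => f (g i)) => y.
have [x <-] := f_surj y; have [c {1}->] := gP x; exists c.
by rewrite linear_sum; apply: eq_bigr => i _; rewrite linearZ.
Qed.

Lemma fg_prod M N :
  finitely_generated M -> finitely_generated N -> finitely_generated (M * N)%type.
Proof.
case=> m [g gP] [n [h hP]].
apply: (@fg_finType _ ('I_m + 'I_n)%type
  (fun i => match i with inl i => (g i, 0) | inr j => (0, h j) end)) => -[x y].
have [c xE] := gP x; have [d yE] := hP y.
exists (fun i => match i with inl i => c i | inr j => d j end).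
rewrite big_sumType /=.
have -> : \sum_i c i *: ((g i, 0) : M * N) = (x, 0).
  rewrite xE; elim/big_ind2 : _ => // [? u ? v -> ->|i _].
    by rewrite /GRing.add /= /add_pair /= addr0.
  by rewrite /GRing.scale /= /scale_pair /= scaler0.
have -> : \sum_j d j *: ((0, h j) : M * N) = (0, y).
  rewrite yE; elim/big_ind2 : _ => // [? u ? v -> ->|i _].
    by rewrite /GRing.add /= /add_pair /= addr0.
  by rewrite /GRing.scale /= /scale_pair /= scaler0.
by rewrite /GRing.add /= /add_pair /= addr0 add0r.
Qed.

Definition unit_vec n (i : 'I_n) : {ffun 'I_n -> R^o} := [ffun j => (j == i)%:R].

Lemma unit_vecP n (x : {ffun 'I_n -> R^o}) : x = \sum_i x i *: unit_vec i.
Proof.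
apply/ffunP => j; rewrite sum_ffunE (bigD1 j) //= big1 => [|i /negPf ij].
  by rewrite !ffunE eqxx /= addr0 -[RHS]/(_ * _) mulr1.
by rewrite !ffunE eq_sym ij -[LHS]/(_ * _) mulr0.
Qed.

Lemma fg_free n : finitely_generated ({ffun 'I_n -> R^o} : lmodType R).
Proof. by exists n, (@unit_vec n) => x; exists x; exact: unit_vecP. Qed.

Lemma comb_linear M n (g : 'I_n -> M) :
  linear (fun c : {ffun 'I_n -> R^o} => \sum_i (c i : R) *: g i).
Proof.
move=> a x y; rewrite scaler_sumr -big_split /=; apply: eq_bigr => i _.
by rewrite !ffunE scalerDl scalerA.
Qed.

Definition comb M n (g : 'I_n -> M) : {linear {ffun 'I_n -> R^o} -> M} :=
  mklin (comb_linear g).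

(** The idempotent [f] splits [M] as its image [U] plus its kernel. Both summands are quotients of
    [M], which gives the finite generation that [karoubi_closed] asks for. *)
Lemma karoubi_retract (C : lmodType R -> Prop) M (U : M -> Prop)
    (hU : is_submodule U) (f : {linear M -> M}) :
  strictly_full C -> karoubi_closed C -> finitely_generated M -> C M ->
  (forall x, U (f x)) -> (forall x, U x -> f x = x) -> C (sub hU).
Proof.
move=> Cfull Ckar Mfg CM fU fid.
pose f' := corestr hU fU.
have lg : linear (fun x => x - f x).
  by move=> a x y; rewrite (linearP f) scalerBr opprD addrACA.
pose g := mklin lg.
have gker x : f (g x) = 0 by rewrite linearB (fid (f x)) // subrr.
pose hK := submod_ker f.
pose g' := corestr hK gker.
have fst_surj (y : sub hU) : exists x, f' x = y.
  exists (sub_incl hU y); apply: sub_val_inj.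
  by rewrite /= fid //; exact: sub_valK.
have snd_surj (y : sub hK) : exists x, g' x = y.
  exists (sub_incl hK y); apply: sub_val_inj => /=.
  by rewrite (sub_valK y) subr0.
apply: (Ckar (sub hU) (sub hK)); [exact: fg_surj fst_surj Mfg | exact: fg_surj snd_surj Mfg |].
have lfg : linear (fun x => (f' x, g' x)).
  by move=> a x y; rewrite !linearP.
apply: (Cfull _ _ (mklin lfg)) => //.
exists (fun p : sub hU * sub hK => sub_incl hU p.1 + sub_incl hK p.2) => [x|[x y]] /=.
  by rewrite addrC subrK.
have fx : f (sub_incl hU x) = sub_incl hU x by rewrite fid //; exact: sub_valK.
have fy : f (sub_incl hK y) = 0 := sub_valK y.
have e : f (sub_val x + sub_val y) = sub_val x by rewrite linearD fx fy addr0.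
congr (_, _); apply: sub_val_inj => /=; first exact: e.
by rewrite e addrAC subrr add0r.
Qed.

End FinitelyGenerated.

(** * Presentations *)

Section Presentations.

Context {R : pzRingType}.
Implicit Types M X : lmodType R.

(* [A] lists [m] relations, as rows, between the [n] generators [g]. *)
Definition presents m n (A : 'I_m -> 'I_n -> R) M (g : 'I_n -> M) : Prop :=
  (forall x, exists c : 'I_n -> R, x = \sum_i c i *: g i) /\
  forall c : 'I_n -> R, \sum_i c i *: g i = 0 <->
    exists d : 'I_m -> R, forall i, c i = \sum_j d j * A j i.

Lemma presents_rel m n (A : 'I_m -> 'I_n -> R) M (g : 'I_n -> M) j :
  presents A g -> \sum_i A j i *: g i = 0.
Proof.
case=> _ /(_ (A j))[_]; apply; exists (fun j' => (j' == j)%:R) => i.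
rewrite (bigD1 j) //= eqxx mul1r big1 ?addr0 // => j' /negPf ->.
by rewrite mul0r.
Qed.

Lemma presents_eq m n (A : 'I_m -> 'I_n -> R) M (g : 'I_n -> M) X
    (u v : {linear M -> X}) :
  presents A g -> (forall i, u (g i) = v (g i)) -> forall x, u x = v x.
Proof.
move=> [gP _] uv x; have [c ->] := gP x.
by rewrite !linear_sum; apply: eq_bigr => i _; rewrite !linearZ uv.
Qed.

Lemma presents_hom m n (A : 'I_m -> 'I_n -> R) M (g : 'I_n -> M) X (x : 'I_n -> X) :
  presents A g -> (forall j, \sum_i A j i *: x i = 0) ->
  exists u : {linear M -> X}, forall i, u (g i) = x i.
Proof.
move=> [gP gR] hx.
have [c cP] := choice gP.
have wd (d : 'I_n -> R) : \sum_i d i *: g i = 0 -> \sum_i d i *: x i = 0.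
  move/gR => [e eP].
  under eq_bigr => i _ do rewrite eP scaler_suml.
  rewrite exchange_big big1 // => j _.
  under eq_bigr => i _ do rewrite -scalerA.
  by rewrite -scaler_sumr hx scaler0.
have wd2 (d e : 'I_n -> R) : \sum_i d i *: g i = \sum_i e i *: g i ->
    \sum_i d i *: x i = \sum_i e i *: x i.
  move=> /eqP; rewrite -subr_eq0 -sumrB => /eqP de; apply/eqP.
  rewrite -subr_eq0 -sumrB; under eq_bigr => i _ do rewrite -scalerBl.
  apply/eqP/wd; rewrite -[RHS]de; apply: eq_bigr => i _; exact: scalerBl.
have lu : linear (fun y => \sum_i c y i *: x i).
  move=> a y z; rewrite scaler_sumr -big_split /=.
  under [RHS]eq_bigr => i _ do rewrite scalerA -scalerDl.
  apply: wd2; rewrite -cP.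
  under eq_bigr => i _ do rewrite scalerDl -scalerA.
  by rewrite big_split /= -scaler_sumr -!cP.
exists (mklin lu) => i /=.
have -> : x i = \sum_j (j == i)%:R *: x j.
  rewrite (bigD1 i) //= eqxx scale1r big1 ?addr0 // => j /negPf ->.
  by rewrite scale0r.
apply: wd2; rewrite -cP (bigD1 i) //= eqxx scale1r big1 ?addr0 // => j /negPf ->.
by rewrite scale0r.
Qed.

End Presentations.

(** * Modules over an artin algebra *)

Section Restriction.

Context {k : comPzRingType} {R : algType k}.
Implicit Types M N : lmodType R.

(** Restriction of scalars to [k], on an alias so that the two scalar actions do not collide. *)
Definition resk M : Type := M.
HB.instance Definition _ M := GRing.Zmodule.on (resk M).

Section Scale.

Context (M : lmodType R).

Definition resk_scale (a : k) (x : resk M) : resk M := (a%:A : R) *: (x : M).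

Fact resk_scaleA a b v : resk_scale a (resk_scale b v) = resk_scale (a * b) v.
Proof. by rewrite /resk_scale scalerA -scalerAl mul1r scalerA. Qed.

Fact resk_scale1 : left_id 1 resk_scale.
Proof. by move=> x; rewrite /resk_scale !scale1r. Qed.

Fact resk_scaleDr : right_distributive resk_scale +%R.
Proof. by move=> a x y; rewrite /resk_scale scalerDr. Qed.

Fact resk_scaleDl v : {morph resk_scale^~ v : a b / a + b}.
Proof. by move=> a b; rewrite /resk_scale scalerDl scalerDl. Qed.

End Scale.

HB.instance Definition _ M := GRing.Zmodule_isLmodule.Build k (resk M)
  (@resk_scaleA M) (@resk_scale1 M) (@resk_scaleDr M) (@resk_scaleDl M).

Lemma reskE M (a : k) (x : M) : a *: (x : resk M) = ((a%:A : R) *: x : M).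
Proof. by []. Qed.

Lemma resk_submod M (U : M -> Prop) :
  is_submodule U -> is_submodule (U : resk M -> Prop).
Proof. by move=> hU; split=> [|a]; [exact: hU.1 | exact: hU.2]. Qed.

Lemma resk_fg M : finitely_generated (R : lmodType k) -> finitely_generated M ->
  finitely_generated (resk M : lmodType k).
Proof.
move=> [m [e eP]] [n [g gP]].
apply: (@fg_finType _ _ ('I_n * 'I_m)%type (fun i => e i.2 *: g i.1 : resk M)) => x.
have [c ->] := gP x.
have [d dP] := choice (fun i => eP (c i)).
exists (fun i => d i.1 i.2).
rewrite -(pair_bigA _ (fun i j => d i j *: (e j *: g i : resk M))) /=.
apply: eq_bigr => i _; rewrite {1}(dP i) scaler_suml; apply: eq_bigr => j _.
by rewrite reskE scalerA -scalerAl mul1r.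
Qed.

End Restriction.

Lemma fg_ffun (k : pzRingType) (V : lmodType k) n :
  finitely_generated V -> finitely_generated ({ffun 'I_n -> V} : lmodType k).
Proof.
move=> [m [g gP]].
apply: (@fg_finType _ _ ('I_n * 'I_m)%type
  (fun p => [ffun i => if i == p.1 then g p.2 else 0])) => x.
have [c cP] := choice (fun i => gP (x i)).
exists (fun p => c p.1 p.2).
apply/ffunP => i.
rewrite -(pair_bigA _ (fun p q =>
  c p q *: [ffun i => if i == p then g q else 0] : {ffun _ -> V})) /=.
rewrite sum_ffunE (bigD1 i) //= [X in _ = _ + X]big1 => [|j /negPf ji]; last first.
  rewrite sum_ffunE big1 // => q _.
  by rewrite !ffunE eq_sym ji scaler0.
rewrite sum_ffunE addr0 {1}cP; apply: eq_bigr => j _.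
by rewrite !ffunE eqxx.
Qed.

(** * The cogenerators [Hom_k(R^n, E)], the Nakayama functor and the duality pairing *)

Section Cogenerators.

Context {k : comPzRingType} {R : algType k} {E : lmodType k}.
Implicit Types M N X : lmodType R.

Definition dual_pred n (f : {ffun 'I_n -> R} -> E) : Prop := linear f.

Fact dual_submod n : is_submodule (@dual_pred n).
Proof.
split=> [a x y|a f g hf hg b x y]; first by rewrite scaler0 addr0.
rewrite -![(a *: f + g) _]/(a *: f _ + g _) hf hg !scalerDr !scalerA.
by rewrite [a * b]mulrC addrACA.
Qed.

(* [Hom_k(R^n, E)], a power of the injective cogenerator [D R]; [R] acts
   through right multiplication on [R^n]. *)
Definition cogen n : Type := sub (dual_submod n).
HB.instance Definition _ n := GRing.Zmodule.on (cogen n).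

Definition cfun n (phi : cogen n) : {linear {ffun 'I_n -> R} -> E} :=
  mklin (sub_valK phi).

Definition mk_cogen n (f : {linear {ffun 'I_n -> R} -> E}) : cogen n :=
  insub_ (dual_submod n) (linearP f).

Lemma mk_cogenE n (f : {linear {ffun 'I_n -> R} -> E}) x : cfun (mk_cogen f) x = f x.
Proof. by []. Qed.

Lemma cogenP n (phi psi : cogen n) : (forall x, cfun phi x = cfun psi x) -> phi = psi.
Proof. by move=> h; apply: sub_val_inj; apply/funext => x; exact: h. Qed.

Lemma cfunD n (phi psi : cogen n) x : cfun (phi + psi) x = cfun phi x + cfun psi x.
Proof. by []. Qed.

Lemma cfun0 n x : cfun (0 : cogen n) x = 0.
Proof. by []. Qed.

Definition rmul n (x : {ffun 'I_n -> R}) (r : R) : {ffun 'I_n -> R} :=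
  [ffun i => x i * r].

Lemma cogen_scale_linear n r (phi : cogen n) : linear (fun x => cfun phi (rmul x r)).
Proof.
move=> a x y; rewrite -linearP; congr (cfun phi _).
by apply/ffunP => i; rewrite !ffunE mulrDl scalerAl.
Qed.

Definition cogen_scale n r (phi : cogen n) : cogen n :=
  mk_cogen (mklin (cogen_scale_linear r phi)).

Fact cogen_scaleA n a b v :
  cogen_scale a (cogen_scale b v) = cogen_scale (a * b) v :> cogen n.
Proof.
apply: cogenP => x; congr (cfun v _).
by apply/ffunP => i; rewrite !ffunE mulrA.
Qed.

Fact cogen_scale1 n : left_id 1 (@cogen_scale n).
Proof.
move=> v; apply: cogenP => x; congr (cfun v _).
by apply/ffunP => i; rewrite !ffunE mulr1.
Qed.

Fact cogen_scaleDr n : right_distributive (@cogen_scale n) +%R.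
Proof. by move=> a x y; apply: cogenP. Qed.

Fact cogen_scaleDl n v : {morph (@cogen_scale n)^~ v : a b / a + b}.
Proof.
move=> a b; apply: cogenP => x.
rewrite /= [RHS](_ : _ = cfun v (rmul x a) + cfun v (rmul x b)) // -linearD.
by congr (cfun v _); apply/ffunP => i; rewrite !ffunE mulrDr.
Qed.

HB.instance Definition _ n := GRing.Zmodule_isLmodule.Build R (cogen n)
  (@cogen_scaleA n) (@cogen_scale1 n) (@cogen_scaleDr n) (@cogen_scaleDl n).

Lemma cfunZ n r (phi : cogen n) x : cfun (r *: phi) x = cfun phi (rmul x r).
Proof. by []. Qed.

Lemma cfunZk n (a : k) (phi : cogen n) x :
  cfun ((a%:A : R) *: phi) x = a *: cfun phi x.
Proof.
rewrite cfunZ -linearZ; congr (cfun phi _).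
by apply/ffunP => i; rewrite !ffunE -scalerAr mulr1.
Qed.

Definition evec n (i : 'I_n) : {ffun 'I_n -> R} := [ffun j => (j == i)%:R].

Lemma evecP n (x : {ffun 'I_n -> R}) : x = \sum_i rmul (evec i) (x i).
Proof.
apply/ffunP => j; rewrite sum_ffunE (bigD1 j) //= big1 => [|i /negPf ij].
  by rewrite !ffunE eqxx mul1r addr0.
by rewrite !ffunE eq_sym ij mul0r.
Qed.

Lemma cfun_evec n (phi : cogen n) x : cfun phi x = \sum_i cfun (x i *: phi) (evec i).
Proof. by rewrite {1}(evecP x) linear_sum. Qed.

Lemma ev_linear X n (F : {linear X -> cogen n}) y :
  linear (fun x : resk X => cfun (F x) y).
Proof. by move=> a u v; rewrite reskE linearP cfunD cfunZk. Qed.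

Definition ev X n (F : {linear X -> cogen n}) y : {linear resk X -> E} :=
  mklin (ev_linear F y).

Section ToCogen.

Context X n (f : 'I_n -> {linear resk X -> E}).

Lemma to_cogen_linear1 x : linear (fun y : {ffun 'I_n -> R} => \sum_i f i (y i *: x)).
Proof.
move=> a y z; rewrite scaler_sumr -big_split /=; apply: eq_bigr => i _.
have -> : (a *: y + z) i *: x = a *: (y i *: x : resk X) + (z i *: x : resk X).
  by rewrite !ffunE reskE scalerDl scalerA -scalerAl mul1r.
exact: linearP.
Qed.

Lemma to_cogen_linear : linear (fun x => mk_cogen (mklin (to_cogen_linear1 x))).
Proof.
move=> a x y; apply: cogenP => z.
rewrite cfunD cfunZ !mk_cogenE /= -big_split /=; apply: eq_bigr => i _.
by rewrite -linearD scalerDr scalerA ffunE.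
Qed.

(** One direction of the adjunction between [Hom_R(X, Hom_k(R^n, E))] and [Hom_k(X, E)^n];
    evaluation at the vectors [evec i] is the inverse. *)
Definition to_cogen : {linear X -> cogen n} := mklin to_cogen_linear.

Lemma to_cogenE x y : cfun (to_cogen x) y = \sum_i f i (y i *: x).
Proof. by []. Qed.

Lemma to_cogen_evec x i : cfun (to_cogen x) (evec i) = f i x.
Proof.
rewrite to_cogenE (bigD1 i) //= big1 => [|j /negPf ji].
  by rewrite ffunE eqxx scale1r addr0.
by rewrite ffunE ji scale0r linear0.
Qed.

End ToCogen.

Lemma cogen_ext X n (F G : {linear X -> cogen n}) :
  (forall x i, cfun (F x) (evec i) = cfun (G x) (evec i)) -> forall x, F x = G x.
Proof.
move=> FG x; apply: cogenP => y; rewrite !cfun_evec; apply: eq_bigr => i _.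
by rewrite -!linearZ FG.
Qed.

Definition mat_mul m n (A : 'I_m -> 'I_n -> R) (y : {ffun 'I_n -> R}) : {ffun 'I_m -> R} :=
  [ffun j => \sum_i A j i * y i].

Lemma mat_mul_linear m n (A : 'I_m -> 'I_n -> R) : linear (mat_mul A).
Proof.
move=> a x y; apply/ffunP => j; rewrite !ffunE scaler_sumr -big_split.
by apply: eq_bigr => i _; rewrite !ffunE mulrDr scalerAr.
Qed.

Lemma nakayama_linear m n (A : 'I_m -> 'I_n -> R) :
  linear (fun phi : cogen m =>
    mk_cogen (mklin (linearP (cfun phi \o mklin (mat_mul_linear A)))) : cogen n).
Proof.
move=> a phi psi; apply: cogenP => x.
rewrite cfunD cfunZ !mk_cogenE /=.
congr (sub_val phi _ + _); apply/ffunP => j; rewrite !ffunE mulr_suml.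
by apply: eq_bigr => i _; rewrite ffunE mulrA.
Qed.

(* The Nakayama functor [D Hom(-, R)] on the map [R^m -> R^n] with matrix [A]. *)
Definition nakayama m n (A : 'I_m -> 'I_n -> R) : {linear cogen m -> cogen n} :=
  mklin (nakayama_linear A).

Lemma nakayamaE m n (A : 'I_m -> 'I_n -> R) phi x :
  cfun (nakayama A phi) x = cfun phi (mat_mul A x).
Proof. by []. Qed.

Lemma nakayama_evec m n (A : 'I_m -> 'I_n -> R) phi i :
  cfun (nakayama A phi) (evec i) = \sum_j cfun (A j i *: phi) (evec j).
Proof.
rewrite nakayamaE cfun_evec; apply: eq_bigr => j _.
rewrite ffunE (bigD1 i) //= big1 => [|i' /negPf ii].
  by rewrite ffunE eqxx mulr1 addr0.
by rewrite ffunE ii mulr0.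
Qed.

(** [F] is read as [n] functionals on [X], applied to the tuple [u (g i)]. When [g] generates [M]
    with relations [A], maps [M -> X] are the tuples killed by [A], so every [F] that factors
    through [nakayama A] pairs to zero. *)
Definition pairing n M (g : 'I_n -> M) X (F : {linear X -> cogen n})
  (u : M -> X) : E := \sum_i cfun (F (u (g i))) (evec i).

Lemma pairing_nakayama m n (A : 'I_m -> 'I_n -> R) M (g : 'I_n -> M) X
    (H : {linear X -> cogen m}) (u : {linear M -> X}) :
  presents A g -> pairing g (nakayama A \o H) u = 0.
Proof.
move=> gP; rewrite /pairing.
under eq_bigr => i _ do rewrite nakayama_evec.
rewrite exchange_big big1 // => j _.
under eq_bigr => i _ do rewrite -!linearZ.
rewrite -[LHS](linear_sum (ev H (evec j))) /= -linear_sum (presents_rel j gP).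
by rewrite !linear0.
Qed.

Hypotheses (hR : artin_algebra R) (hE : is_dualizing_module E).

Let hk : artinian k. Proof. by case: hR. Qed.
Let Rfg : finitely_generated (R : lmodType k). Proof. by case: hR. Qed.

Lemma fg_sub M (U : M -> Prop) (hU : is_submodule U) :
  finitely_generated M -> finitely_generated (sub hU).
Proof.
move=> Mfg.
have [_ _ noeth] := fg_matlis_reflexive hk hE (resk_fg Rfg Mfg) (submod_zero (resk M)).
have [|n [w [Uw wP]]] := noeth _ (resk_submod hU).
  by move=> u ->; exact: (submod0 hU).
exists n, (fun i => insub_ hU (Uw i)) => x.
have [c [u [-> e]]] := wP _ (sub_valK x).
exists (fun i => (c i)%:A); apply: sub_val_inj.
rewrite e add0r -[RHS]/(sub_incl hU _) linear_sum.
by apply: eq_bigr => i _; rewrite linearZ.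
Qed.

(** Finitely many functionals generate the dual of [M/U], and functionals separate points outside
    [U]. This embeds [M/U] without forming a quotient module. *)
Lemma cogen_embed M (U : M -> Prop) : finitely_generated M -> is_submodule U ->
  exists n (F : {linear M -> cogen n}), forall x, F x = 0 <-> U x.
Proof.
move=> Mfg hU; have hUk := resk_submod hU.
have [[n [f [fU fgen]]] _ _] := fg_matlis_reflexive hk hE (resk_fg Rfg Mfg) hUk.
exists n, (to_cogen f) => x; split=> [Fx|Ux].
  apply: contrapT => nUx; have [h [hU0 []]] := separate hk hE hUk nUx.
  have [c ->] := fgen h hU0; rewrite big1 // => i _.
  by rewrite -to_cogen_evec Fx cfun0 scaler0.
apply: cogenP => y; rewrite to_cogenE big1 // => i _.
by apply: fU; exact: submodZ.
Qed.

Lemma cogen_fg n : finitely_generated (cogen n : lmodType R).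
Proof.
have [[m [f [_ fgen]]] _ _] :=
  fg_matlis_reflexive hk hE (fg_ffun n Rfg) (submod_zero {ffun 'I_n -> R}).
exists m, (fun i => mk_cogen (f i)) => phi.
have [|c cP] := fgen (cfun phi); first by move=> u ->; exact: linear0.
exists (fun i => (c i)%:A); apply: cogenP => x; rewrite cP.
rewrite -[RHS](_ : \sum_i cfun ((c i)%:A *: mk_cogen (f i)) x = _); last first.
  by elim/big_ind2 : _ => // ? y ? z -> ->; rewrite cfunD.
by apply: eq_bigr => i _; rewrite cfunZk.
Qed.

(** Evaluating [F phi] at [evec i] is a functional of [phi], hence, by reflexivity of [R^m],
    evaluation of [phi] at some vector; that vector is column [i] of [A]. *)
Lemma cogen_hom m n (F : {linear cogen m -> cogen n}) :
  exists A : 'I_m -> 'I_n -> R, forall phi, F phi = nakayama A phi.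
Proof.
have [_ bd _] :=
  fg_matlis_reflexive hk hE (fg_ffun m Rfg) (submod_zero {ffun 'I_m -> R}).
have col i : exists x : {ffun 'I_m -> R}, forall phi, cfun (F phi) (evec i) = cfun phi x.
  have [a f g h _ _ hh|x xP] := bd (fun f => cfun (F (mk_cogen f)) (evec i)).
    rewrite -cfunZk -cfunD -linearP; congr (cfun (F _) _).
    by apply: cogenP => x; rewrite cfunD cfunZk !mk_cogenE hh.
  exists x => phi; rewrite -[RHS]xP; last by move=> u ->; exact: linear0.
  by congr (cfun (F _) _); exact: cogenP.
have [x xP] := choice col.
exists (fun j i => x i j); apply: (@cogen_ext _ _ F (nakayama _)) => phi i.
by rewrite xP nakayama_evec cfun_evec.
Qed.

Lemma fg_presents M : finitely_generated M ->
  exists m n (A : 'I_m -> 'I_n -> R) (g : 'I_n -> M), presents A g.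
Proof.
move=> [n [g gP]].
have [m [r rP]] := fg_sub (submod_ker (comb g)) (@fg_free R n).
exists m, n, (fun j i => sub_incl _ (r j) i), g; split=> // c; split=> [c0|[d dP]].
  have h : comb g [ffun i => c i] = 0.
    by rewrite -[RHS]c0; apply: eq_bigr => i _; rewrite ffunE.
  have [d dP] := rP (insub_ (submod_ker (comb g)) h).
  exists d => i.
  have /(congr1 (sub_incl _)) := dP; rewrite linear_sum => /ffunP/(_ i).
  rewrite sum_ffunE /= ffunE => ->; apply: eq_bigr => j _.
  by rewrite ffunE.
have -> : \sum_i c i *: g i = \sum_j d j *: comb g (sub_incl _ (r j)).
  under eq_bigr => i _ do rewrite dP scaler_suml.
  rewrite exchange_big; apply: eq_bigr => j _.
  by rewrite /= scaler_sumr; apply: eq_bigr => i _; rewrite scalerA.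
by rewrite big1 // => j _; rewrite (sub_valK (r j)) scaler0.
Qed.

(** The cokernel of [A] is realised as the image of a map from [R^n] to a cogenerator whose kernel
    is the row span. *)
Lemma presents_exists m n (A : 'I_m -> 'I_n -> R) :
  exists (M : lmodType R) (g : 'I_n -> M), finitely_generated M /\ presents A g.
Proof.
pose a j : {ffun 'I_n -> R^o} := [ffun i => A j i].
have [l [F FP]] := cogen_embed (@fg_free R n) (submod_im (comb a)).
pose hI := submod_im F.
have FI x : exists y, F x = F y by exists x.
pose F' := corestr hI FI.
have F'_surj y : exists x, F' x = y.
  have [x xP] := sub_valK y; exists x; exact: sub_val_inj.
exists (sub hI), (fun i => F' (unit_vec i)); split.
  exact: fg_surj F'_surj (@fg_free R n).
have F'E (c : 'I_n -> R) : \sum_i c i *: F' (unit_vec i) = F' [ffun i => c i].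
  rewrite [in RHS](unit_vecP [ffun i => c i]) linear_sum; apply: eq_bigr => i _.
  by rewrite linearZ ffunE.
split=> [y|c].
  by have [x <-] := F'_surj y; exists x; rewrite F'E; congr (F' _); apply/ffunP => i; rewrite ffunE.
rewrite F'E; have -> : (F' [ffun i => c i] = 0) <-> F [ffun i => c i] = 0.
  by split=> [/(congr1 (sub_incl hI))|e]; [|apply: sub_val_inj].
rewrite FP; split=> [[d dP]|[d dP]].
  exists d => i; have /ffunP/(_ i) := dP; rewrite ffunE => ->.
  by rewrite /= sum_ffunE; apply: eq_bigr => j _; rewrite !ffunE.
exists [ffun j => d j]; apply/ffunP => i; rewrite ffunE dP /= sum_ffunE.
by apply: eq_bigr => j _; rewrite !ffunE.
Qed.

Section Duality.

Context m n (A : 'I_m -> 'I_n -> R) M (g : 'I_n -> M) (gP : presents A g).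

(** On [X^n] the functional attached to [F] vanishes on the kernel of [A : X^n -> X^m], so it
    factors through [A]; the components of the factor on [X^m] form [H]. *)
Lemma pairing_lift X (F : {linear X -> cogen n}) :
  (forall u : {linear M -> X}, pairing g F u = 0) ->
  exists H : {linear X -> cogen m}, forall x, F x = nakayama A (H x).
Proof.
move=> F0.
have lT : linear (fun x : {ffun 'I_n -> resk X} =>
    [ffun j => \sum_i A j i *: (x i : X)] : {ffun 'I_m -> resk X}).
  move=> a x y; apply/ffunP => j; rewrite !ffunE reskE scaler_sumr -big_split.
  apply: eq_bigr => i _; rewrite !ffunE reskE /= scalerDr !scalerA.
  by rewrite -scalerAl -scalerAr mulr1 mul1r.
have lf : linear (fun x : {ffun 'I_n -> resk X} => \sum_i cfun (F (x i)) (evec i)).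
  move=> a x y; rewrite scaler_sumr -big_split /=; apply: eq_bigr => i _.
  by rewrite !ffunE; exact: (ev_linear F (evec i)).
(* A tuple killed by [A] satisfies the relations of [M], so it comes from a map [u : M -> X]. *)
have [x /ffunP Tx|h hP] := @factor_functional _ _ hE _ _ (mklin lT) (mklin lf).
  have [|u uP] := @presents_hom R m n A M g X (fun i => x i : X) gP.
    by move=> j; have := Tx j; rewrite !ffunE.
  by rewrite -[RHS](F0 u); apply: eq_bigr => i _; rewrite uP.
have lh j : linear (fun y : resk X => h [ffun j' => if j' == j then y else 0]).
  move=> a y z; rewrite -linearP; congr (h _); apply/ffunP => j'; rewrite !ffunE.
  by case: eqP; rewrite // scaler0 addr0.
exists (to_cogen (fun j => mklin (lh j))).
apply: (@cogen_ext _ _ F (nakayama A \o to_cogen _)) => x i.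
rewrite nakayama_evec.
transitivity (mklin lf [ffun i' => if i' == i then x else 0]).
  rewrite -[RHS]/(\sum_i' cfun (F ([ffun i'' => if i'' == i then x else 0] i')) (evec i')).
  rewrite (bigD1 i) // [X in _ = _ + X]big1 => [|i' /negPf ii]; first by rewrite ffunE eqxx addr0.
  by rewrite ffunE ii linear0 cfun0.
rewrite hP.
under [RHS]eq_bigr => j _ do rewrite -linearZ to_cogen_evec /=.
rewrite -linear_sum; congr (h _); apply/ffunP => j; rewrite !ffunE sum_ffunE.
rewrite (bigD1 i) //= big1 => [|i' /negPf ii]; last by rewrite !ffunE ii scaler0.
rewrite [RHS](bigD1 j) //= big1 => [|j' /negPf jj]; last by rewrite ffunE eq_sym jj.
by rewrite !ffunE !eqxx !addr0.
Qed.

(** [Hom(M, X)] sits in [X^n] as the submodule [K]; a functional on it extends to [X^n] by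
    injectivity of [E]. *)
Lemma pairing_full X (phi : {linear M -> X} -> E) :
  (forall a (u v w : {linear M -> X}), (forall x, w x = (a%:A : R) *: u x + v x) ->
     phi w = a *: phi u + phi v) ->
  exists F : {linear X -> cogen n}, forall u, phi u = pairing g F u.
Proof.
move=> phiP.
pose K (x : {ffun 'I_n -> resk X}) := exists u : {linear M -> X}, forall i, u (g i) = x i.
have linK a (x y : {ffun 'I_n -> resk X}) (u v : {linear M -> X}) :
    (forall i, u (g i) = x i) -> (forall i, v (g i) = y i) ->
    exists w : {linear M -> X}, (forall z, w z = (a%:A : R) *: u z + v z) /\
       forall i, w (g i) = (a *: x + y) i.
  move=> ux vy; exists (clin_fun a u v); split=> // i.
  by rewrite /= /clin_fun ux vy !ffunE.
have hK : is_submodule K.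
  split=> [|a x y [u ux] [v vy]]; first by exists \0 => i; rewrite ffunE.
  by have [w [_ wP]] := linK a x y u v ux vy; exists w.
have /choice[s sP] : forall x : {ffun 'I_n -> resk X}, exists u : {linear M -> X},
    K x -> forall i, u (g i) = x i.
  move=> x; have [[u ux]|nK] := EM (K x); first by exists u.
  by exists \0.
pose phi' x := phi (s x).
have phi'E (x : {ffun 'I_n -> resk X}) (u : {linear M -> X}) :
    (forall i, u (g i) = x i) -> phi' x = phi u.
  move=> ux; have vx := sP x (ex_intro _ u ux); rewrite /phi'; set v := s x in vx *.
  have uv : forall z, u z = v z.
    by apply: (presents_eq gP) => i; rewrite ux vx.
  (* The linearity hypothesis with coefficient 1 and second term 0 shows that [phi] depends only on
     the values of its argument. *)
  have h (w : {linear M -> X}) : (forall z, w z = v z) -> phi w = 1 *: phi v + phi \0.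
    by move=> wz; apply: phiP => z; rewrite wz scale1r scale1r addr0.
  by rewrite (h u uv) -(h v).
have [a x y [u ux] [v vy]|h hP] := extend_functional hE (phi := phi') hK.
  have [w [wz wP]] := linK a x y u v ux vy.
  by rewrite (phi'E _ _ ux) (phi'E _ _ vy) (phi'E _ w) //; exact: phiP.
have lh i : linear (fun y : resk X => h [ffun i' => if i' == i then y else 0]).
  move=> a y z; rewrite -linearP; congr (h _); apply/ffunP => i'; rewrite !ffunE.
  by case: eqP; rewrite // scaler0 addr0.
exists (to_cogen (fun i => mklin (lh i))) => u.
rewrite -(phi'E [ffun i => u (g i)]); last by move=> i; rewrite ffunE.
rewrite -hP; last by exists u => i; rewrite ffunE.
rewrite /pairing; under eq_bigr => i _ do rewrite to_cogen_evec /=.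
rewrite -linear_sum; congr (h _); apply/ffunP => i; rewrite ffunE sum_ffunE.
rewrite (bigD1 i) //= big1 => [|j /negPf ji]; last by rewrite ffunE eq_sym ji.
by rewrite ffunE eqxx addr0.
Qed.

Lemma pairing_separates X (u v : {linear M -> X}) :
  (forall F : {linear X -> cogen n}, pairing g F u = pairing g F v) ->
  forall x, u x = v x.
Proof.
move=> uv; apply: (presents_eq gP) => i; apply/eqP; rewrite -subr_eq0; apply/eqP.
apply: contrapT => nuv.
have [f [_ []]] := separate hk hE (submod_zero (resk X)) nuv.
pose fs i' : {linear resk X -> E} := if i' == i then f else \0.
have h (w : {linear M -> X}) : pairing g (to_cogen fs) w = f (w (g i)).
  rewrite /pairing; under eq_bigr => j _ do rewrite to_cogen_evec.
  rewrite (bigD1 i) //= big1 => [|j /negPf ji]; last by rewrite /fs ji.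
  by rewrite /fs eqxx addr0.
by rewrite linearB -!h uv subrr.
Qed.

(* Biduality for [Hom(M, X)], its dual being described by [pairing_full]. *)
Lemma pairing_bidual X (Phi : {linear X -> cogen n} -> E) : finitely_generated X ->
  (forall a (F G H : {linear X -> cogen n}),
     (forall u : {linear M -> X}, pairing g H u = a *: pairing g F u + pairing g G u) ->
     Phi H = a *: Phi F + Phi G) ->
  exists u : {linear M -> X}, forall F, Phi F = pairing g F u.
Proof.
move=> Xfg PhiP.
have Vfg := fg_ffun n (resk_fg Rfg Xfg).
have [_ bd _] := fg_matlis_reflexive hk hE Vfg (submod_zero {ffun 'I_n -> resk X}).
have lc i : linear (fun y : resk X =>
    [ffun i' => if i' == i then y else 0] : {ffun 'I_n -> resk X}).
  move=> a y z; apply/ffunP => i'; rewrite !ffunE.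
  by case: eqP; rewrite // scaler0 addr0.
pose comp (f : {linear {ffun 'I_n -> resk X} -> E}) i : {linear resk X -> E} :=
  f \o mklin (lc i).
have compE f (u : M -> X) : pairing g (to_cogen (comp f)) u = f [ffun i => u (g i)].
  rewrite /pairing; under eq_bigr => i _ do rewrite to_cogen_evec /=.
  rewrite -linear_sum; congr (f _); apply/ffunP => i; rewrite sum_ffunE ffunE.
  rewrite (bigD1 i) //= big1 => [|j /negPf ji]; last by rewrite ffunE eq_sym ji.
  by rewrite ffunE eqxx addr0.
have [a f f' h _ _ hE'|x xP] := bd (fun f => Phi (to_cogen (comp f))).
  by apply: PhiP => u; rewrite !compE.
have lF (F : {linear X -> cogen n}) :
    linear (fun y : {ffun 'I_n -> resk X} => \sum_i cfun (F (y i)) (evec i)).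
  move=> a y z; rewrite scaler_sumr -big_split /=; apply: eq_bigr => i _.
  by rewrite !ffunE; exact: (ev_linear F (evec i)).
have Phi0 : Phi \0 = 0.
  have h : Phi \0 = 1 *: Phi \0 + Phi \0.
    by apply: PhiP => u; rewrite /pairing big1 ?scaler0 ?addr0.
  by apply: (addrI (Phi \0)); rewrite addr0 {1}[in RHS]h scale1r.
have Phi_eq (F G : {linear X -> cogen n}) :
    (forall u : {linear M -> X}, pairing g F u = pairing g G u) -> Phi F = Phi G.
  move=> FG; rewrite -[RHS]scale1r -[RHS]addr0 -Phi0; apply: PhiP => u.
  by rewrite FG scale1r [X in _ = _ + X]big1 ?addr0.
have PhiE F : Phi F = \sum_i cfun (F (x i)) (evec i).
  rewrite -[RHS]/(mklin (lF F) x) -xP; last by move=> u ->; exact: linear0.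
  apply: Phi_eq => u; rewrite compE.
  by apply: eq_bigr => i _; rewrite ffunE.
have [|u uP] := @presents_hom R m n A M g X (fun i => x i : X) gP; last first.
  by exists u => F; rewrite PhiE; apply: eq_bigr => i _; rewrite uP.
(* If relation [j] failed for the tuple [x], a functional detecting this would give a map through
   [nakayama A] with [Phi] nonzero, although it pairs to zero with every [u]. *)
move=> j; apply: contrapT => nz.
have [f [_ []]] := separate hk hE (submod_zero (resk X)) nz.
pose fs j' : {linear resk X -> E} := if j' == j then f else \0.
have h0 : Phi (nakayama A \o to_cogen fs) = 0.
  rewrite -Phi0; apply: Phi_eq => u.
  by rewrite pairing_nakayama // /pairing big1.
rewrite -[RHS]h0 PhiE.
under [RHS]eq_bigr => i _ do rewrite nakayama_evec.
have fsE j' : \sum_i cfun (A j' i *: to_cogen fs (x i)) (evec j') =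
    fs j' (\sum_i A j' i *: (x i : X) : resk X).
  rewrite (linear_sum (fs j')); apply: eq_bigr => i _.
  by rewrite -linearZ to_cogen_evec.
rewrite [RHS]exchange_big; under [RHS]eq_bigr => j' _ do rewrite fsE.
rewrite [RHS](bigD1 j) //= [X in _ = _ + X]big1 => [|j' /negPf jj].
  by rewrite /fs eqxx addr0.
by rewrite /fs jj.
Qed.

End Duality.

End Cogenerators.

(** * The homotopy category *)

Section Homotopy.

Context {R : pzRingType}.
Implicit Types X Y Z W : complex R.
Implicit Types M N : lmodType R.

Lemma homotopic_ext X Y (f g : cmap X Y) : (forall i x, f i x = g i x) -> homotopic f g.
Proof.
move=> fg; exists (fun _ => \0) => i x.
by rewrite fg subrr /= linear0 addr0.
Qed.

Lemma homotopic_sym X Y (f g : cmap X Y) : homotopic f g -> homotopic g f.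
Proof.
case=> h hh; exists (fun i => \- h i) => i x.
by rewrite -opprB hh /= linearN opprD.
Qed.

Lemma homotopic_trans X Y (f g h : cmap X Y) :
  homotopic f g -> homotopic g h -> homotopic f h.
Proof.
case=> s hs [t ht]; exists (fun i => s i \+ t i) => i x.
by rewrite -(subrKA (g (i + 1) x)) hs ht /= linearD addrACA.
Qed.

Lemma homotopic_compl X Y Z (g : cmap Y Z) (f f' : cmap X Y) :
  homotopic f f' -> homotopic (ccomp g f) (ccomp g f').
Proof.
case=> s hs; exists (fun i => g i \o s i) => i x.
by rewrite /= -linearB hs linearD cmorE.
Qed.

Lemma homotopic_compr X Y Z (g g' : cmap Y Z) (f : cmap X Y) :
  homotopic g g' -> homotopic (ccomp g f) (ccomp g' f).
Proof.
case=> s hs; exists (fun i => s i \o f (i + 1)) => i x.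
by rewrite /= hs cmorE.
Qed.

Lemma ccompA X Y Z W (h : cmap Z W) (g : cmap Y Z) (f : cmap X Y) :
  homotopic (ccomp h (ccomp g f)) (ccomp (ccomp h g) f).
Proof. exact: homotopic_ext. Qed.

Lemma homotopic_idl X Y (f : cmap X Y) (e : cmap Y Y) :
  homotopic e (cid Y) -> homotopic (ccomp e f) f.
Proof.
move=> /(homotopic_compr f) h; apply: homotopic_trans h _.
exact: homotopic_ext.
Qed.

Lemma homotopic_idr X Y (f : cmap X Y) (e : cmap X X) :
  homotopic e (cid X) -> homotopic (ccomp f e) f.
Proof.
move=> /(homotopic_compl f) h; apply: homotopic_trans h _.
exact: homotopic_ext.
Qed.

Lemma homotopic_cancel X Y Z (f : cmap X Y) (g : cmap Y X) (h : cmap X Z) :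
  homotopic (ccomp g f) (cid X) -> homotopic (ccomp (ccomp h g) f) h.
Proof.
move=> gf; apply: homotopic_trans (homotopic_idr h gf).
exact: homotopic_ext.
Qed.

Lemma homotopic_cancell X Y Z (f : cmap X Y) (g : cmap Y X) (h : cmap Z X) :
  homotopic (ccomp g f) (cid X) -> homotopic (ccomp g (ccomp f h)) h.
Proof.
move=> gf; apply: homotopic_trans (homotopic_idl h gf).
exact: homotopic_ext.
Qed.

Lemma homotopy_equivalent_refl X : homotopy_equivalent X X.
Proof. by exists (cid X), (cid X); split; exact: homotopic_ext. Qed.

Lemma quasi_iso_comp X Y Z (g : cmap Y Z) (f : cmap X Y) :
  quasi_iso f -> quasi_iso g -> quasi_iso (ccomp g f).
Proof.
move=> qf qg i; have [fi fs] := qf i; have [gi gs] := qg i; split.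
  move=> x dx gfx; apply: fi => //; apply: gi => //.
  by rewrite -cmorE dx linear0.
move=> z dz; have [y dy [z' zE]] := gs z dz; have [x dx [y' yE]] := fs y dy.
exists x => //; exists (z' + g i y').
by rewrite linearD -zE -cmorE -yE linearB addrA subrK.
Qed.

Lemma quasi_iso_homotopy_equivalence X Y (f : cmap X Y) (g : cmap Y X) :
  homotopic (ccomp g f) (cid X) -> homotopic (ccomp f g) (cid Y) -> quasi_iso f.
Proof.
case=> s sP [t tP] i; split=> [x dx [y yE]|y dy].
  have := sP i x; rewrite dx linear0 addr0 /= -yE cmorE => /esym h.
  exists (g i y - s i x); rewrite linearB h.
  by rewrite opprB [LHS]addrC subrK.
exists (g (i + 1) y); first by rewrite -cmorE dy linear0.
exists (- t i y); rewrite linearN.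
have := tP i y; rewrite dy linear0 addr0 /= => <-.
by rewrite opprB.
Qed.

(** Transport between terms whose degrees are equal but not convertible, such as [i - 1 + 1] and
    [i]. *)
Definition castl X i j (e : i = j) : {linear X i -> X j} :=
  match e with erefl => idfun end.

Lemma castl_id X i (e : i = i) x : castl X e x = x.
Proof. by rewrite (eq_irrelevance e erefl). Qed.

Lemma castlK X i j (e : i = j) (e' : j = i) x : castl X e (castl X e' x) = x.
Proof. by case: _ / e' x e => x e; rewrite castl_id. Qed.

Lemma castl_irr X i j (e e' : i = j) x : castl X e x = castl X e' x.
Proof. by rewrite (eq_irrelevance e e'). Qed.

Lemma castl_comp X i j l (e : i = j) (e' : j = l) x :
  castl X e' (castl X e x) = castl X (etrans e e') x.
Proof. by case: _ / e'. Qed.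

Lemma castl_diff X i j (e : i = j) (e' : i + 1 = j + 1) x :
  cdiff X j (castl X e x) = castl X e' (cdiff X i x).
Proof. by case: _ / e e' => e'; rewrite !castl_id. Qed.

(** The map is [g = f - (d h + h d)]. Since [h] starts in degree [i + 1], the term [d h] in a
    general degree [j] is reached through a cast from [j - 1 + 1]. *)
Lemma homotopy_perturb X Y (f : cmap X Y) (h : forall i, {linear X (i + 1) -> Y i}) :
  exists g : cmap X Y, forall i x,
    f (i + 1) x - g (i + 1) x = cdiff Y i (h i x) + h (i + 1) (cdiff X (i + 1) x).
Proof.
pose b j (x : X j) : Y j := castl Y (subrK 1 j)
  (cdiff Y (j - 1) (h (j - 1) (castl X (esym (subrK 1 j)) x))).
have bE i x : b (i + 1) x = cdiff Y i (h i x).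
  have gen p (e : p + 1 = i + 1) :
      castl Y e (cdiff Y p (h p (castl X (esym e) x))) = cdiff Y i (h i x).
    by have pi := addIr _ e; subst p; rewrite !castl_id.
  exact: gen.
have lg j : linear (fun x => f j x - (b j x + h j (cdiff X j x))).
  move=> a x y; rewrite /b !(linearP (castl X _)) !(linearP (h _)) !(linearP (cdiff _ _)).
  rewrite !(linearP (castl Y _)) !(linearP (h _)) (linearP (f j)) [X in _ - X]addrACA -scalerDr.
  by rewrite opprD addrACA scalerBr.
have gE i x : mklin (lg (i + 1)) (cdiff X i x) = cdiff Y i (mklin (lg i) x).
  rewrite /= bE cdiffK linear0 addr0 cmorE !linearB linearD.
  suff -> : cdiff Y i (b i x) = 0 by rewrite add0r.
  rewrite /b; move: (subrK 1 i) => e.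
  by rewrite (castl_diff e (congr1 (+%R^~ 1) e)) cdiffK linear0.
exists (CMap gE) => i x.
by rewrite /= bE opprB [LHS]addrC subrK.
Qed.

Lemma zero_at_complex X i : zero_at X i -> forall x y : X i, x = y.
Proof. by move=> z x y; rewrite (z x) (z y). Qed.

Lemma zero_moduleP (x : zero_module (R := R)) : x = 0.
Proof. exact: thinmx0. Qed.

Lemma stalk_zero M i : i != 0 -> zero_at (stalk M) i.
Proof. by case: i => [[|n]|n] // _ x; exact: zero_moduleP. Qed.

Section StalkMap.

Context M X (u : {linear M -> X 0}) (du : forall x, cdiff X 0 (u x) = 0).

Definition stalk_mor i : {linear stalk M i -> X i} :=
  match i return {linear stalk M i -> X i} with
  | Posz 0 => u
  | _ => \0
  end.

Lemma stalk_morE i x : stalk_mor (i + 1) (cdiff (stalk M) i x) = cdiff X i (stalk_mor i x).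
Proof.
rewrite [cdiff (stalk M) i x](_ : _ = 0) // linear0.
by case: i x => [[|n]|n] x /=; rewrite ?linear0.
Qed.

Definition stalk_cmap : cmap (stalk M) X := CMap stalk_morE.

End StalkMap.

Definition stalk_fun M N (u : {linear M -> N}) : cmap (stalk M) (stalk N) :=
  @stalk_cmap M (stalk N) u (fun _ => erefl).

Lemma stalk_cocycle M X (u : cmap (stalk M) X) (x : M) : cdiff X 0 (u 0 x) = 0.
Proof. by rewrite -[LHS](@cmorE _ _ _ u 0 x) linear0. Qed.

Lemma homotopic_stalk M X (u v : cmap (stalk M) X) :
  homotopic u v <-> exists h : {linear M -> X (Negz 0)},
    forall x : M, u 0 x - v 0 x = cdiff X (Negz 0) (h x).
Proof.
split=> [[h hh]|[h hh]].
  exists (h (Negz 0)) => x; have := hh (Negz 0) x.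
  have e0 : h (Negz 0 + 1) (cdiff (stalk M) (Negz 0 + 1) x) = 0 := linear0 _.
  by rewrite e0 addr0.
exists (fun i => match i return {linear stalk M (i + 1) -> X i} with
                 | Negz 0 => h | _ => \0 end) => i x.
rewrite [cdiff (stalk M) _ _](_ : _ = 0) // [X in _ = _ + X]linear0 addr0.
have [i0|/eqP i1] := eqVneq i (Negz 0); first by subst i; exact: hh.
have x0 : x = 0.
  by apply: stalk_zero; apply/eqP => e; apply: i1; exact: (addIr 1).
by rewrite x0 !linear0 addr0.
Qed.

Lemma homotopic_stalk0 M X (u v : cmap (stalk M) X) :
  (forall x : M, u 0 x = v 0 x) -> homotopic u v.
Proof.
by move=> uv; apply/homotopic_stalk; exists \0 => x; rewrite uv subrr linear0.
Qed.

Lemma homotopic_stalk_eq M N (u v : cmap (stalk M) (stalk N)) :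
  homotopic u v -> forall x : M, u 0 x = v 0 x.
Proof.
by move=> /homotopic_stalk[h hh] x; apply/eqP; rewrite -subr_eq0; apply/eqP; exact: hh.
Qed.

Lemma shift_cmapE X Y (f : cmap X Y) i (x : shift X i) :
  f (i + 1 + 1) (cdiff (shift X) i x) = cdiff (shift Y) i (f (i + 1) x).
Proof. by rewrite /= linearN cmorE. Qed.

Definition shift_cmap X Y (f : cmap X Y) : cmap (shift X) (shift Y) :=
  @CMap R (shift X) (shift Y) (fun i => f (i + 1)) (@shift_cmapE X Y f).

Lemma homotopic_shift X Y (f g : cmap X Y) :
  homotopic f g -> homotopic (shift_cmap f) (shift_cmap g).
Proof.
case=> h hh; exists (fun i => \- h (i + 1)) => i x.
by rewrite /= hh (linearN (cdiff _ _)) (linearN (h _)) !opprK.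
Qed.

Definition le0 X : Prop := forall i, 0 < i -> zero_at X i.

(** A common home for both hearts: [H_A] and [H_C] lie in it, with no condition on the terms. *)
Definition Le0 X : Prop := exists Y, le0 Y /\ homotopy_equivalent X Y.

Lemma le0_Le0 X : le0 X -> Le0 X.
Proof. by exists X; split=> //; exact: homotopy_equivalent_refl. Qed.

Lemma le0_stalk M : le0 (stalk M).
Proof. by move=> i i0; apply: stalk_zero; rewrite gt_eqF. Qed.

Lemma heartA_le0 X : heartA X -> le0 X.
Proof. by case=> _ z _ i i0; apply: z; right. Qed.

Lemma heartA_stalk M : finitely_generated M -> heartA (stalk M).
Proof.
move=> Mfg; split.
- case=> [[|n]|n] //=; exists 0, (fun=> 0) => x; exists (fun=> 0);
    by rewrite big_ord0; exact: zero_moduleP.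
- by move=> i [] i0; apply: stalk_zero; rewrite ?(lt_eqF (lt_trans i0 _)) ?gt_eqF.
move=> i i0 x _; exists 0; rewrite linear0; apply/esym/stalk_zero.
by rewrite lt_eqF.
Qed.

End Homotopy.

(** * Serre duality *)

Lemma addr_swap (V : zmodType) (a b c d : V) : a + b = c + d -> a - c = d - b.
Proof.
move=> e; apply/eqP; rewrite subr_eq addrAC eq_sym subr_eq.
by rewrite e addrC.
Qed.

Section Representation.

Context {k : comPzRingType} {R : algType k} {E : lmodType k}.
Implicit Types X Y S T : complex R.
Implicit Types M N : lmodType R.
Implicit Types P : complex R -> Prop.

(** [is_serre_iso] relative to any full subcategory [P]; it is used for [heartA], [Le0] and
    [heart C]. *)
Definition represents P M S
    (theta : forall X, cmap X S -> cmap (stalk M) X -> E) : Prop :=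
  (forall X, P X ->
     [/\ forall f, in_dual_hom (theta X f),
         forall a f g u,
           theta X (clin a f g) u = a *: theta X f u + theta X g u,
         forall f g, homotopic f g <-> (forall u, theta X f u = theta X g u) &
         forall phi, in_dual_hom phi ->
           exists f, forall u, theta X f u = phi u]) /\
  (forall X Y (v : cmap X Y) (f : cmap Y S) (u : cmap (stalk M) X),
     P X -> P Y -> theta X (ccomp f v) u = theta Y f (ccomp v u)).

Lemma represents_sub P P' M S theta :
  (forall X, P X -> P' X) -> @represents P' M S theta -> @represents P M S theta.
Proof.
by move=> PP' [h n]; split=> [X /PP'|X Y v f u /PP' PX /PP' PY]; [exact: h|exact: n].
Qed.

Section Theory.

Context P M S theta (H : @represents P M S theta).

Arguments theta : clear implicits.

Lemma represents_hom X f g u v : P X -> homotopic f g -> homotopic u v ->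
  theta X f u = theta X g v.
Proof.
move=> PX fg uv; have [d _ i _] := H.1 X PX.
by rewrite (proj1 (i f g) fg); case: (d g) => + _; apply.
Qed.

Lemma represents_inj X f g : P X -> (forall u, theta X f u = theta X g u) -> homotopic f g.
Proof. by move=> PX fg; have [_ _ i _] := H.1 X PX; apply/i. Qed.

Lemma represents_full X phi : P X -> in_dual_hom phi ->
  exists f, forall u, theta X f u = phi u.
Proof. by move=> PX; have [_ _ _] := H.1 X PX; apply. Qed.

Lemma represents_nat X Y v f u : P X -> P Y ->
  theta X (ccomp f v) u = theta Y f (@ccomp R (stalk M) X Y v u).
Proof. exact: H.2. Qed.

Lemma represents_dual X f : P X -> in_dual_hom (theta X f).
Proof. by move=> PX; have [d _ _ _] := H.1 X PX. Qed.

End Theory.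

Lemma in_dual_hom_comp M X Y (v : cmap X Y) (phi : cmap (stalk M) Y -> E) :
  in_dual_hom phi -> in_dual_hom (fun u => phi (ccomp v u)).
Proof.
move=> [ph pl]; split=> [f g fg|a f g]; first exact/ph/homotopic_compl.
rewrite -pl; apply: ph; apply: homotopic_ext => i x.
by rewrite /= /clin_fun linearP.
Qed.

Lemma in_dual_hom_precomp M N X (e : cmap (stalk N) (stalk M))
    (phi : cmap (stalk N) X -> E) :
  in_dual_hom phi -> in_dual_hom (fun u : cmap (stalk M) X => phi (ccomp u e)).
Proof.
move=> [ph pl]; split=> [f g fg|a f g]; first exact/ph/homotopic_compr.
by rewrite -pl; apply: ph; exact: homotopic_ext.
Qed.

Lemma in_dual_hom_scale X Y (phi : cmap X Y -> E) : in_dual_hom phi ->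
  forall a u v w, homotopic w (clin a u v) -> phi w = a *: phi u + phi v.
Proof. by move=> [ph pl] a u v w /ph ->. Qed.

Lemma yoneda P M S S' theta theta' :
  @represents P M S theta -> @represents P M S' theta' -> P S -> P S' ->
  homotopy_equivalent S S'.
Proof.
move=> H H' PS PS'.
have [a aE] := represents_full H' PS (represents_dual H (cid S) PS).
have [b bE] := represents_full H PS' (represents_dual H' (cid S') PS').
exists a, b; split.
  apply: (represents_inj H PS) => u.
  rewrite (represents_nat H) // bE.
  rewrite -[LHS](represents_nat H' _ _ _ PS PS') -[RHS]aE.
  by apply: (represents_hom H') => //; exact: homotopic_ext.
apply: (represents_inj H' PS') => u.
rewrite (represents_nat H') // aE.
rewrite -[LHS](represents_nat H _ _ _ PS' PS) -[RHS]bE.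
by apply: (represents_hom H) => //; exact: homotopic_ext.
Qed.

Hypothesis hE : is_dualizing_module E.

(* The functional lives on the maps [M -> Y^0] of the form [f u + d h]; it is
   extended to all functions from [M] to [Y^0]. *)
Lemma extend_dual_hom M X Y (f : cmap X Y) (phi : cmap (stalk M) X -> E) :
  (forall u v : cmap (stalk M) X, homotopic (ccomp f u) (ccomp f v) -> homotopic u v) ->
  in_dual_hom phi ->
  exists psi : cmap (stalk M) Y -> E,
    in_dual_hom psi /\ forall u, psi (ccomp f u) = phi u.
Proof.
move=> f_inj phiP.
pose V : lmodType k := M -> resk (Y 0).
pose rel (w : V) (u : cmap (stalk M) X) := exists h : {linear M -> Y (Negz 0)},
  forall x, w x = f 0 (u 0 x) + (cdiff Y (Negz 0) (h x) : Y 0).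
have relP (a : k) (w w' : V) u u' : rel w u -> rel w' u' -> rel (a *: w + w') (clin a u u').
  move=> [h hw] [h' hw']; exists (clin_fun a h h') => x.
  have -> : (a *: w + w') x = a *: w x + w' x by [].
  rewrite hw hw' reskE /= /clin_fun (linearP (f 0)) (linearP (cdiff Y _)).
  by rewrite scalerDr addrACA.
have rel_eq w u v : rel w u -> rel w v -> homotopic u v.
  move=> [h hw] [h' hw']; apply: f_inj; apply/homotopic_stalk.
  exists (h' \- h) => x; rewrite /= linearB.
  by apply: (@addr_swap (Y 0)); rewrite -hw -hw'.
have rel0 : rel 0 (czero _ _).
  by exists \0 => x; rewrite /= (linear0 (f 0)) (linear0 (cdiff _ _)) addr0.
have hU : is_submodule (fun w => exists u, rel w u).
  split=> [|a w w' [u wu] [u' wu']]; last by exists (clin a u u'); exact: relP.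
  by exists (czero _ _).
have /choice[s sP] : forall w, exists u, (exists u, rel w u) -> rel w u.
  move=> w; have [[u wu]|no] := EM (exists u, rel w u); first by exists u.
  by exists (czero _ _).
have sE w u : rel w u -> phi (s w) = phi u.
  move=> wu; apply: phiP.1.
  exact: rel_eq (sP w (ex_intro _ u wu)) wu.
have [a w w' [u wu] [u' wu']|h hP] := extend_functional hE (phi := phi \o s) hU.
  by rewrite /= (sE _ _ wu) (sE _ _ wu') (sE _ _ (relP a _ _ _ _ wu wu')) phiP.2.
have hrel w u : rel w u -> h w = phi u by move=> wu; rewrite hP; [exact: sE|exists u].
exists (fun v : cmap (stalk M) Y => h (fun x => v 0 x : Y 0)); split; last first.
  by move=> u; apply: hrel; exists \0 => x; rewrite /= linear0 addr0.
split=> [v v' /homotopic_stalk[t tE]|a v v'].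
  apply/eqP; rewrite -subr_eq0 -linearB; apply/eqP.
  rewrite (hrel _ (czero _ _)).
    by rewrite -(hrel _ _ rel0) linear0.
  by exists t => x; rewrite /= linear0 add0r -tE.
by rewrite -linearP.
Qed.

(** As [P_M] lies in [P], a monomorphism [f] is injective on maps out of [P_M]. The functional
    attached to [u] therefore extends along [f], and the extension is represented by the required
    map. *)
Lemma represents_injective P M S theta : @represents P M S theta ->
  P S -> P (stalk M) -> injective_in P S.
Proof.
move=> H PS PM; split=> // X Y f u PX PY fmono.
have [psi [psiP psiE]] := extend_dual_hom
  (fun u v => fmono (stalk M) u v PM) (represents_dual H u PX).
have [v vE] := represents_full H PY psiP.
exists v; apply: (represents_inj H PX) => w.
by rewrite (represents_nat H) // vE psiE.
Qed.

End Representation.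

Lemma posz_succ_gt0 (i : nat) : 0 < Posz i + 1.
Proof. by rewrite -[Posz i + 1]/(Posz (i + 1)) addn1. Qed.

Section SerreComplex.

Context {k : comPzRingType} {R : algType k} {E : lmodType k}.
Implicit Types X Y S T : complex R.
Implicit Types M N : lmodType R.

Local Notation J n := (@cogen k R E n : lmodType R).

Section Objects.

Context m n (A : 'I_m -> 'I_n -> R).

Definition serre_ob (i : int) : lmodType R :=
  match i with
  | Posz 0 => J n
  | Negz 0 => J m
  | Negz 1 => sub (submod_ker (@nakayama k R E m n A))
  | _ => zero_module
  end.

Definition serre_diff (i : int) : {linear serre_ob i -> serre_ob (i + 1)} :=
  match i return {linear serre_ob i -> serre_ob (i + 1)} with
  | Negz 0 => nakayama A
  | Negz 1 => sub_incl _
  | _ => \0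
  end.

Lemma serre_diffK i x : serre_diff (i + 1) (serre_diff i x) = 0.
Proof.
case: i x => [[|i]|[|[|i]]] x /=; rewrite ?linear0 //.
exact: (sub_valK x).
Qed.

Definition serre_complex : complex R := Complex serre_diffK.

Lemma serre_complex_zero i : i < - 2%:Z \/ 0 < i -> zero_at serre_complex i.
Proof. by case: i => [[|i]|[|[|i]]] // [] // _ x; exact: zero_moduleP. Qed.

Lemma serre_complex_exact (i : int) : i + 1 < 0 -> exact_at_succ serre_complex i.
Proof.
case: i => [i|[|[|[|i]]]] // _ x dx.
- by exists (insub_ (submod_ker (nakayama A)) dx).
- by exists 0; apply: sub_val_inj; rewrite linear0 [RHS]dx.
by exists 0; rewrite linear0; apply/esym; exact: zero_moduleP.
Qed.

(** A homotopy is determined by its part [h] out of degree 0: the remaining difference in degree -1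
    falls into the kernel of [nakayama A], which is the term in degree -2. *)
Lemma serre_homotopic X (f f' : cmap X serre_complex) (h : {linear X 0 -> J m}) :
  (forall x : X 0, f 0 x - f' 0 x = nakayama A (h x) :> J n) -> homotopic f f'.
Proof.
move=> fh.
have lg : linear (fun x : X (Negz 0) =>
    (f (Negz 0) x - f' (Negz 0) x - h (cdiff X (Negz 0) x) : J m)).
  move=> a x y; rewrite (linearP (f _)) (linearP (f' _)) (linearP (cdiff _ _)).
  by rewrite (linearP h) !opprD !scalerBr [X in X + _]addrACA [LHS]addrACA.
have dg x : nakayama A (mklin lg x) = 0.
  have fE : nakayama A (f (Negz 0) x) = f 0 (cdiff X (Negz 0) x) := esym (cmorE f x).
  have fE' : nakayama A (f' (Negz 0) x) = f' 0 (cdiff X (Negz 0) x) := esym (cmorE f' x).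
  transitivity (nakayama A (f (Negz 0) x - f' (Negz 0) x - h (cdiff X (Negz 0) x) : J m)) => //.
  by rewrite linearB linearB fE fE' fh subrr.
pose h' := corestr (submod_ker (nakayama A)) dg.
exists (fun i => match i return {linear X (i + 1) -> serre_ob i} with
                 | Negz 0 => h | Negz 1 => h' | _ => \0 end).
case=> [i|[|[|i]]] x.
- by rewrite [LHS]serre_complex_zero ?[RHS]serre_complex_zero //; right; rewrite posz_succ_gt0.
- by rewrite [LHS]fh addr0.
- by rewrite /= subrK.
case: i x => [|i] x; last by apply: zero_at_complex; apply: serre_complex_zero; left.
have fE : f (Negz 0) (cdiff X (Negz 1) x) = sub_incl _ (f (Negz 1) x) := cmorE f x.
have fE' : f' (Negz 0) (cdiff X (Negz 1) x) = sub_incl _ (f' (Negz 1) x) := cmorE f' x.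
have dd : cdiff X (Negz 0) (cdiff X (Negz 1) x) = 0 := @cdiffK _ X (Negz 1) x.
rewrite /= add0r; apply: sub_val_inj.
transitivity (f (Negz 0) (cdiff X (Negz 1) x) - f' (Negz 0) (cdiff X (Negz 1) x)
  - h (cdiff X (Negz 0) (cdiff X (Negz 1) x)) : J m) => //.
by rewrite dd linear0 subr0 fE fE' -linearB.
Qed.

Lemma serre_cmap X (f0 : {linear X 0 -> J n}) (f1 : {linear X (Negz 0) -> J m}) :
  zero_at X 1 ->
  (forall x, nakayama A (f1 x) = f0 (cdiff X (Negz 0) x)) ->
  exists f : cmap X serre_complex,
    (forall x : X 0, f 0 x = f0 x) /\ forall x : X (Negz 0), f (Negz 0) x = f1 x.
Proof.
move=> X1 f01.
have df1 x : nakayama A ((f1 \o cdiff X (Negz 1)) x) = 0.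
  have dd : cdiff X (Negz 0) (cdiff X (Negz 1) x) = 0 := @cdiffK _ X (Negz 1) x.
  by rewrite f01 dd linear0.
pose f2 := corestr (submod_ker (nakayama A)) df1.
pose f i : {linear X i -> serre_ob i} :=
  match i return {linear X i -> serre_ob i} with
  | Posz 0 => f0 | Negz 0 => f1 | Negz 1 => f2 | _ => \0 end.
have fE i x : f (i + 1) (cdiff X i x) = serre_diff i (f i x).
  case: i x => [i|[|[|[|i]]]] x.
  - apply: (@zero_at_complex _ serre_complex); apply: serre_complex_zero; right.
    exact: posz_succ_gt0.
  - exact: esym (f01 x).
  - by [].
  - have dd : cdiff X (Negz 1) (cdiff X (Negz 2) x) = 0 := @cdiffK _ X (Negz 2) x.
    by apply: sub_val_inj; rewrite /= dd linear0.
  by apply: (@zero_at_complex _ serre_complex (Negz i.+3 + 1)); apply: serre_complex_zero; left.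
by exists (@CMap _ X serre_complex f fE).
Qed.

End Objects.

Section Pairing.

Context m n (A : 'I_m -> 'I_n -> R) M (g : 'I_n -> M) (gP : presents A g).

Let S := serre_complex A.

Definition serre_pairing X (f : cmap X S) (u : cmap (stalk M) X) : E :=
  pairing g (f 0 : {linear X 0 -> J n}) (u 0).

(** The image of [u] consists of cocycles, so on it [f] and [f'] differ by [nakayama A] of the
    homotopy. *)
Lemma serre_pairing_homl X (f f' : cmap X S) u :
  homotopic f f' -> serre_pairing f u = serre_pairing f' u.
Proof.
case=> h hh; apply/eqP; rewrite -subr_eq0 -sumrB; apply/eqP.
pose H : {linear M -> J m} := h (Negz 0) \o (u 0 : {linear M -> X 0}).
rewrite -[RHS](pairing_nakayama H idfun gP); apply: eq_bigr => i _.
have := hh (Negz 0) (u 0 (g i)).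
have -> : cdiff X (Negz 0 + 1) (u 0 (g i)) = 0 by exact: stalk_cocycle.
rewrite linear0 addr0 => e.
exact: (congr1 (fun phi : @cogen k R E n => cfun phi (evec i)) e).
Qed.

(** As [f] is a chain map, [f^0 d h] is [nakayama A] applied to [f^-1 h]. *)
Lemma serre_pairing_homr X (f : cmap X S) u u' :
  homotopic u u' -> serre_pairing f u = serre_pairing f u'.
Proof.
move=> /homotopic_stalk[h hh]; apply/eqP; rewrite -subr_eq0 -sumrB; apply/eqP.
pose H : {linear M -> J m} := f (Negz 0) \o h.
rewrite -[RHS](pairing_nakayama H idfun gP); apply: eq_bigr => i _.
have e : f 0 (u 0 (g i)) - f 0 (u' 0 (g i)) = nakayama A (H (g i)) :> J n.
  by rewrite -linearB hh; exact: (@cmorE _ _ _ f (Negz 0)).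
exact: (congr1 (fun phi : @cogen k R E n => cfun phi (evec i)) e).
Qed.

Lemma serre_pairing_linl X a (f f' : cmap X S) u :
  serre_pairing (clin a f f') u = a *: serre_pairing f u + serre_pairing f' u.
Proof.
rewrite /serre_pairing /pairing scaler_sumr -big_split /=.
by apply: eq_bigr => i _; rewrite -cfunZk -cfunD.
Qed.

Lemma serre_pairing_linr X a (f : cmap X S) u u' :
  serre_pairing f (clin a u u') = a *: serre_pairing f u + serre_pairing f u'.
Proof.
rewrite /serre_pairing /pairing scaler_sumr -big_split /=.
by apply: eq_bigr => i _; rewrite -cfunZk -cfunD -linearP.
Qed.

Lemma serre_pairing_dual X (f : cmap X S) : in_dual_hom (serre_pairing f).
Proof.
by split=> [u v|a u v]; [exact: serre_pairing_homr | exact: serre_pairing_linr].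
Qed.

Hypothesis hE : is_dualizing_module E.

(** With [X^1 = 0] every linear map [M -> X^0] is a chain map, so [pairing_lift] applies to
    [f^0 - f'^0]; the lift [X^0 -> J m] is the homotopy. *)
Lemma serre_pairing_faithful_le0 X (f f' : cmap X S) : zero_at X 1 ->
  (forall u, serre_pairing f u = serre_pairing f' u) -> homotopic f f'.
Proof.
move=> X1 ff.
have [u|H HE] := @pairing_lift k R E hE m n A M g gP (X 0) (f 0 \- f' 0 : {linear X 0 -> J n}).
  have du x : cdiff X 0 (u x) = 0 by exact: X1.
  have /eqP := ff (stalk_cmap du); rewrite -subr_eq0 -sumrB => /eqP <-.
  exact: eq_bigr.
exact: serre_homotopic HE.
Qed.

(** [pairing_full] gives the degree 0 component [F]. Since [phi] kills null-homotopic maps, [F d]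
    pairs to zero, and its lift through [nakayama A] is the component in degree -1. *)
Lemma serre_pairing_full_le0 X (phi : cmap (stalk M) X -> E) : zero_at X 1 ->
  in_dual_hom phi -> exists f : cmap X S, forall u, serre_pairing f u = phi u.
Proof.
move=> X1 phiP.
have du (u : {linear M -> X 0}) x : cdiff X 0 (u x) = 0 by exact: X1.
have [a u v w uvw|F FE] :=
    @pairing_full k R E hE m n A M g gP (X 0) (fun u => phi (stalk_cmap (du u))).
  apply: (in_dual_hom_scale phiP); apply: homotopic_stalk0 => x.
  by rewrite /= /clin_fun uvw.
have FE' (u : cmap (stalk M) X) : phi u = pairing g F (u 0).
  by rewrite -FE; apply: phiP.1; exact: homotopic_stalk0.
have [u|H HE] :=
    @pairing_lift k R E hE m n A M g gP _ (F \o (cdiff X (Negz 0) : {linear X (Negz 0) -> X 0})).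
  have duu x : cdiff X 0 ((cdiff X (Negz 0) \o u : M -> X 0) x) = 0 by exact: X1.
  rewrite [LHS](_ : _ = phi (stalk_cmap duu)); last by rewrite FE'.
  have -> : phi (stalk_cmap duu) = phi (czero _ _).
    apply: phiP.1; apply/homotopic_stalk; exists u => x.
    by rewrite /= subr0.
  by rewrite FE' /pairing big1 // => i _; rewrite linear0.
have [f [fE _]] := @serre_cmap _ _ A X F H X1 (fun x => esym (HE x)).
by exists f => u; rewrite FE'; apply: eq_bigr => i _; rewrite fE.
Qed.

Lemma serre_represents : represents (@Le0 R) serre_pairing.
Proof.
split=> [X [Y [Y0 [a [b [ba ab]]]]]|//]; split.
- exact: serre_pairing_dual.
- exact: serre_pairing_linl.
- move=> f f'; split=> [ff u|ff]; first exact: serre_pairing_homl.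
  have : homotopic (ccomp f b) (ccomp f' b).
    by apply: serre_pairing_faithful_le0 => [|w]; [exact: Y0 | exact: (ff (ccomp b w))].
  move=> /(homotopic_compr a) h.
  apply: homotopic_trans (homotopic_sym (homotopic_cancel f ba)) _.
  exact: homotopic_trans h (homotopic_cancel f' ba).
move=> phi phiP.
have [f fE] := @serre_pairing_full_le0 Y _ (Y0 1 isT) (in_dual_hom_comp b phiP).
exists (ccomp f a) => u.
rewrite [LHS](fE (ccomp a u)); apply: phiP.1; exact: homotopic_cancell.
Qed.

End Pairing.

Hypotheses (hR : artin_algebra R) (hE : is_dualizing_module E).

Lemma heartA_serre m n (A : 'I_m -> 'I_n -> R) : heartA (serre_complex A).
Proof.
split; last exact: serre_complex_exact; last exact: serre_complex_zero.
have fg0 : finitely_generated (zero_module : lmodType R).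
  exists 0, (fun=> 0) => x; exists (fun=> 0); rewrite big_ord0; exact: zero_moduleP.
case=> [[|i]|[|[|i]]] //=; try exact: cogen_fg.
by apply: (fg_sub hR hE); exact: cogen_fg hR hE _.
Qed.

Lemma heartA_Le0 X : heartA X -> Le0 X.
Proof. by move=> /heartA_le0; exact: le0_Le0. Qed.

Lemma serre_complex_is_serre m n (A : 'I_m -> 'I_n -> R) M (g : 'I_n -> M) :
  finitely_generated M -> presents A g -> is_serre_object E M (serre_complex A).
Proof.
move=> Mfg gP.
have H := represents_sub heartA_Le0 (serre_represents gP hE).
split; last by exists (@serre_pairing _ _ A M g).
by apply: (represents_injective hE H); [exact: heartA_serre | exact: heartA_stalk].
Qed.

Lemma serreA_spec M : finitely_generated M -> is_serre_object E M (serreA E M).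
Proof.
move=> Mfg; apply: ClassicalEpsilon.epsilon_spec.
have [m [n [A [g gP]]]] := fg_presents hR hE Mfg.
by exists (serre_complex A); exact: serre_complex_is_serre gP.
Qed.

Lemma serreA_equivalent m n (A : 'I_m -> 'I_n -> R) M (g : 'I_n -> M) :
  finitely_generated M -> presents A g ->
  homotopy_equivalent (serreA E M) (serre_complex A).
Proof.
move=> Mfg gP; have [[hA _] [theta H]] := serreA_spec Mfg.
apply: (yoneda (P := heartA) H) => //; last exact: heartA_serre.
exact: represents_sub heartA_Le0 (serre_represents gP hE).
Qed.

End SerreComplex.

(** * Hearts and approximations *)

Section Subcategory.

Context {R : pzRingType} {C : lmodType R -> Prop}.
Implicit Types X Y Z T : complex R.
Implicit Types M N : lmodType R.

Hypotheses (hCA : forall M : lmodType R, C M -> finitely_generated M)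
  (hCadd : additive_subcat C) (hCfull : strictly_full C) (hCkar : karoubi_closed C).

Lemma subcat_zero M : (forall x : M, x = 0) -> C M.
Proof.
move=> M0; apply: (hCfull (f := \0 : {linear zero_module -> M})) hCadd.1.
by exists (fun=> 0) => x; [exact: esym (zero_moduleP _) | rewrite [RHS]M0].
Qed.

Lemma subcat_retract M (U : M -> Prop) (hU : is_submodule U) (f : {linear M -> M}) :
  C M -> (forall x, U (f x)) -> (forall x, U x -> f x = x) -> C (sub hU).
Proof. by move=> CM; apply: karoubi_retract => //; exact: hCA. Qed.

Lemma Kminus_stalk M : C M -> Kminus C (stalk M).
Proof.
move=> CM; split; last by exists 0; exact: le0_stalk.
by case=> [[|i]|i] //; apply: subcat_zero; exact: zero_moduleP.
Qed.

Lemma Kplus_stalk M : C M -> Kplus C (stalk M).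
Proof.
move=> CM; split; first exact: (Kminus_stalk CM).1.
by exists 0 => i i0; apply: stalk_zero; rewrite lt_eqF.
Qed.

Lemma Kminus_shift X : Kminus C X -> Kminus C (shift X).
Proof.
move=> [CX [n X0]]; split=> [i|]; first exact: CX.
by exists n => i ni; apply: X0; apply: lt_trans ni _; rewrite ltrDl.
Qed.

(** It is the degree 0 component of a coapproximation of [P_N]: a map [N -> M'] is a map of stalk
    complexes, and homotopic maps between stalks are equal. *)
Lemma left_approximation N : coapproximating C -> finitely_generated N ->
  exists (M : lmodType R) (e : {linear N -> M}), C M /\
    forall M' (t : {linear N -> M'}), C M' ->
      exists s : {linear M -> M'}, forall x, t x = s (e x).
Proof.
move=> co Nfg.
have [|Y [q [[CY _] _ qY]]] := co (stalk N).
  have [fg _ _] := heartA_stalk Nfg; split=> //.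
  by exists 0 => i i0; apply: stalk_zero; rewrite lt_eqF.
exists (Y 0), (q 0); split=> // M' t CM'.
have [_ /(_ (stalk_fun t))[f ft]] := qY _ (Kplus_stalk CM').
by exists (f 0) => x; rewrite -(homotopic_stalk_eq ft).
Qed.

Lemma heart_Kminus X : heart C X -> Kminus C X.
Proof. by case=> [[]]. Qed.

Lemma heart_Le0 X : heart C X -> Le0 X.
Proof. by case=> [[_ [Y [_ Y0 XY]]] _]; exists Y. Qed.

Lemma Tge0_equivalent X Y : homotopy_equivalent X Y -> Kminus C Y -> Tge0 C X -> Tge0 C Y.
Proof.
case=> a [b [ba ab]] CY [CX X0]; split=> // Z f Z0.
have /(homotopic_compl a) h := X0 Z (ccomp b f) Z0.
apply: homotopic_trans (homotopic_sym (homotopic_cancell f ab)) _.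
by apply: homotopic_trans h _; apply: homotopic_ext => i x; exact: linear0.
Qed.

Lemma heart_le0_model X : heart C X ->
  exists Y, [/\ heart C Y, le0 Y & homotopy_equivalent X Y].
Proof.
case=> [[CX [Y [CY Y0 XY]]] Xge]; exists Y; split=> //; split.
  by split=> //; exists Y; split=> //; exact: homotopy_equivalent_refl.
exact: Tge0_equivalent Xge.
Qed.

(* Vanishing of [Hom(Y[1], X)] need only be checked when [Y] lives in degrees
   [<= 0]; then [Y[1]] lives in degrees [< 0]. *)
Lemma Tge0_intro X : Kminus C X ->
  (forall Y (f : cmap (shift Y) X), Kminus C Y -> le0 Y -> homotopic f (czero _ _)) ->
  Tge0 C X.
Proof.
move=> CX h; split=> // Y f [_ [Y' [CY' Y'0 [a [b [ba ab]]]]]].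
have /(homotopic_compr (shift_cmap a)) h0 := h Y' (ccomp f (shift_cmap b)) CY' Y'0.
have ba1 : homotopic (ccomp (shift_cmap b) (shift_cmap a)) (cid (shift Y)).
  apply: homotopic_trans (homotopic_trans _ (homotopic_shift ba)) _; exact: homotopic_ext.
apply: homotopic_trans (homotopic_sym (homotopic_cancel f ba1)) _.
by apply: homotopic_trans h0 _; exact: homotopic_ext.
Qed.

Lemma heart_stalk M : C M -> heart C (stalk M).
Proof.
move=> CM; have KM := Kminus_stalk CM; split.
  split=> //; exists (stalk M); split=> //; first exact: le0_stalk.
  exact: homotopy_equivalent_refl.
apply: Tge0_intro => // Y f CY Y0; apply: homotopic_ext => i x.
have [i0|i0] := eqVneq i 0; last exact: zero_at_complex (stalk_zero (M := M) i0) _ _.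
by subst i; rewrite (Y0 1 isT x) linear0.
Qed.

Section Truncation.

Context Z (Z0 : le0 Z) (CZ : Kminus C Z).

(** It selects all of [Z (j - 1)] for [j <= 0] and zero for [j > 0], so that the type of the terms
    involves no case distinction on the degree. *)
Definition trunc_pred j (z : Z (j - 1)) : Prop := 0 < j -> z = 0.

Fact trunc_submod j : is_submodule (@trunc_pred j).
Proof.
by split=> // a x y hx hy j0; rewrite hx // hy // scaler0 addr0.
Qed.

Definition trunc_ob j : lmodType R := sub (@trunc_submod j).

Definition trunc_cast (j : int) : j - 1 + 1 = j + 1 - 1 := etrans (subrK 1 j) (esym (addrK 1 j)).

(** The sign cancels the one built into [shift]. *)
Definition trunc_mor j : {linear trunc_ob j -> Z (j + 1 - 1)} :=
  if j < 0 then (\- (castl Z (trunc_cast j) \o cdiff Z (j - 1) \o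
    sub_incl (@trunc_submod j)) : {linear trunc_ob j -> Z (j + 1 - 1)})
  else \0.

Fact trunc_morP j x : @trunc_pred (j + 1) (trunc_mor j x).
Proof.
rewrite /trunc_pred /trunc_mor => j0; case: ifP => // j0'.
by move: j0; rewrite ltzD1 leNgt j0'.
Qed.

Definition trunc_diff j : {linear trunc_ob j -> trunc_ob (j + 1)} :=
  corestr (@trunc_submod (j + 1)) (@trunc_morP j).

Lemma trunc_diffK j x : trunc_diff (j + 1) (trunc_diff j x) = 0.
Proof.
apply: sub_val_inj; rewrite /= {1}/trunc_mor; case: ifP => // j0.
rewrite /= /trunc_mor (lt_trans _ j0) ?ltrDl //= !linearN opprK.
have e : j - 1 + 1 + 1 = j + 1 - 1 + 1 by rewrite (trunc_cast j).
by rewrite (castl_diff _ e) cdiffK !linear0.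
Qed.

(* [trunc[1]] is the brutal truncation of [Z] to degrees [< 0]. *)
Definition trunc : complex R := Complex trunc_diffK.

Lemma Tle0_trunc : Tle0 C trunc.
Proof.
have tr0 : le0 trunc.
  by move=> j j0 x; apply: sub_val_inj; exact: (sub_valK x j0).
have Ct : Kminus C trunc.
  split; last by exists 0.
  move=> j; have CZj := CZ.1 (j - 1).
  have [j0|j0] := boolP (0 < j).
    by apply: (subcat_retract _ (f := \0)) => // x /(_ j0).
  by apply: (subcat_retract _ (f := idfun)) => // x; rewrite /trunc_pred (negPf j0).
by split=> //; exists trunc; split=> //; exact: homotopy_equivalent_refl.
Qed.

Definition trunc_proj_fun (i : int) : {linear Z i -> Z (i + 1 - 1)} :=
  if i < 0 then castl Z (esym (addrK 1 i)) else \0.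

Fact trunc_projP i (z : Z i) : @trunc_pred (i + 1) (trunc_proj_fun i z).
Proof. by rewrite /trunc_proj_fun /trunc_pred ltzD1 leNgt => /negPf ->. Qed.

Definition trunc_proj_mor i : {linear Z i -> shift trunc i} :=
  corestr (@trunc_submod (i + 1)) (@trunc_projP i).

Fact trunc_projE i z :
  trunc_proj_mor (i + 1) (cdiff Z i z) = cdiff (shift trunc) i (trunc_proj_mor i z).
Proof.
apply: sub_val_inj; rewrite /= /trunc_mor /trunc_proj_fun; case: ifP => //= i0; last first.
  by rewrite oppr0.
rewrite (lt_trans _ i0) ?ltrDl // opprK.
have e : i + 1 = i + 1 - 1 + 1 by rewrite subrK.
by rewrite (castl_diff _ e) [RHS]castl_comp; exact: castl_irr.
Qed.

Definition trunc_proj : cmap Z (shift trunc) := CMap trunc_projE.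

(** Subtracting the homotopy [h] leaves a map that vanishes in degrees [>= 0]. It factors through
    [trunc[1]], from which every map to [X] is null-homotopic. *)
Lemma Tge0_kill X (g : cmap Z X) (h : {linear Z 0 -> X (Negz 0)}) : Tge0 C X ->
  (forall z : Z 0, g 0 z = cdiff X (Negz 0) (h z)) -> homotopic g (czero Z X).
Proof.
move=> Xge gh.
pose hs i := match i return {linear Z (i + 1) -> X i} with
             | Negz 0 => h | _ => \0 end.
have [g' g'E] := homotopy_perturb g hs.
have gg' : homotopic g g' by exists hs.
have g'0 i z : 0 <= i -> g' i z = 0.
  have [e|i0] := eqVneq i 0; last by move=> i1; rewrite (Z0 _ z) ?linear0 // lt_neqAle eq_sym i0.
  subst i => _.
  have e : g 0 z - g' 0 z = g 0 z by rewrite [LHS](g'E (Negz 0)) /= addr0 -gh.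
  by apply: oppr_inj; apply: (addrI (g 0 z)); rewrite oppr0 addr0.
pose f i : {linear shift trunc i -> X i} :=
  g' i \o castl Z (addrK 1 i) \o sub_incl (@trunc_submod (i + 1)).
have fE i x : f (i + 1) (cdiff (shift trunc) i x) = cdiff X i (f i x).
  rewrite /f /= /trunc_mor; case: ifP => /= [i0|/negbT].
    have e : i + 1 - 1 + 1 = i + 1 by rewrite subrK.
    rewrite opprK castl_comp -cmorE (castl_diff _ e); congr (g' _ _).
    exact: castl_irr.
  rewrite -leNgt oppr0 !linear0 -cmorE => i0; rewrite g'0 //.
apply: homotopic_trans gg' _.
have /(homotopic_compr trunc_proj) := Xge.2 trunc (CMap fE) Tle0_trunc.
move=> h1; apply: homotopic_trans (homotopic_trans _ h1) _; apply: homotopic_ext => // i x.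
rewrite /= /f /= /trunc_proj_fun; case: ifP => [i0|/negbT]; first by rewrite castlK.
by rewrite -leNgt => i0; rewrite g'0 // !linear0.
Qed.

End Truncation.

End Subcategory.

(** * Recognising [Tle0] by maps from objects of [C] placed in positive degrees *)

Section TruncationAbove.

Context {R : pzRingType} {C : lmodType R -> Prop}.
Implicit Types X Y Z T : complex R.
Implicit Types M N : lmodType R.

Hypotheses (hCA : forall M : lmodType R, C M -> finitely_generated M)
  (hCadd : additive_subcat C) (hCfull : strictly_full C) (hCkar : karoubi_closed C).

Lemma concentrated_cmap M T j (p : {linear M -> T j}) :
  C M -> (forall x, cdiff T j (p x) = 0) ->
  exists Z (P : cmap Z T), [/\ Kminus C Z, forall i, i != j -> zero_at Z i,
    forall i y, cdiff Z i y = 0 &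
    exists iota : {linear M -> Z j}, forall x, P j (iota x) = p x].
Proof.
move=> CM dp.
pose U i (x : M) := i != j -> x = 0.
have hU i : is_submodule (U i).
  by split=> // a x y Ux Uy ij; rewrite Ux // Uy // scaler0 addr0.
pose Z : complex R := @Complex R (fun i => sub (hU i)) (fun i => \0) (fun i x => erefl).
pose Pm i : {linear Z i -> T i} :=
  if @eqP _ j i is ReflectT e then castl T e \o p \o sub_incl (hU i) else \0.
have PE i x : Pm (i + 1) (cdiff Z i x) = cdiff T i (Pm i x).
  rewrite [LHS]linear0 /Pm; case: eqP => [e|] /=; last by rewrite linear0.
  by rewrite (castl_diff _ (congr1 (+%R^~ 1) e)) dp linear0.
exists Z, (CMap PE); split=> //.
- split; last first.
    exists j => i ji x; apply: sub_val_inj; apply: (sub_valK x).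
    by rewrite gt_eqF.
  move=> i /=; have [ij|ij] := eqVneq i j.
    by apply: (subcat_retract hCA hCfull hCkar _ (f := idfun)) => // x; rewrite /U ij eqxx.
  by apply: (subcat_retract hCA hCfull hCkar _ (f := \0)) => // x; rewrite /U => ->.
- by move=> i ij x; apply: sub_val_inj; exact: (sub_valK x ij).
have idU x : U j (idfun x) by rewrite /U eqxx.
exists (corestr (hU j) idU) => x /=.
by rewrite /Pm; case: eqP => // e /=; rewrite castl_id.
Qed.

(** This spells out that every map to [T] from an object of [C] placed in a degree [i + 1 > 0] is
    null-homotopic. *)
Definition acyclic_above T : Prop := forall i, 0 <= i ->
  forall M (p : {linear M -> T (i + 1)}), C M -> (forall x, cdiff T (i + 1) (p x) = 0) ->
  exists s : {linear M -> T i}, forall x, p x = cdiff T i (s x).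

(** Descending induction from the upper bound of [T]. Given a splitting [s] one degree higher,
    [1 - s d] projects [T^(i+1)] onto its cocycles, and acyclicity for [M = T^(i+1)], itself in [C],
    lifts this projection through [d]. *)
Lemma acyclic_above_splits T : Kminus C T -> acyclic_above T ->
  forall i, exists s : {linear T (i + 1) -> T i},
    0 <= i -> forall z, cdiff T (i + 1) z = 0 -> cdiff T i (s z) = z.
Proof.
move=> [CT [n Tn]] acT i; have [i0|_] := boolP (0 <= i); last by exists \0.
suff /(_ `|n - i|%N) h : forall d : nat, n < i + 1 + d%:Z ->
    exists s : {linear T (i + 1) -> T i},
    forall z, cdiff T (i + 1) z = 0 -> cdiff T i (s z) = z.
  have [|s sP] := h; last by exists s.
  rewrite addrAC ltzD1 -lerBlDl; exact: ler_norm.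
move=> d; elim: d i i0 => [|d IHd] i i0 nd.
  by exists \0 => z _; rewrite linear0 [RHS](Tn _ _) // -[i + 1]addr0.
have [||s sP] := IHd (i + 1).
- by rewrite addr_ge0.
- by rewrite -addrA -intS.
have lp : linear (fun x : T (i + 1) => x - s (cdiff T (i + 1) x)).
  by move=> a x y; rewrite (linearP (cdiff _ _)) (linearP s) scalerBr opprD addrACA.
have [|x /=|t tP] := acT i i0 _ (mklin lp); first exact: CT.
  by rewrite linearB sP ?subrr // cdiffK.
by exists t => z dz; rewrite -tP /= dz linear0 subr0.
Qed.

(* With [s] as above, [h = s (1 - s d)] contracts [T] in positive degrees, and
   [1 - (d h + h d)] is an idempotent onto the truncation of [T] in degrees [<= 0]. *)
Lemma acyclic_above_Tle0 T : Kminus C T -> acyclic_above T -> Tle0 C T.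
Proof.
move=> CT acT; split=> //.
pose s i := projT1 (boolp.cid (acyclic_above_splits CT acT i)).
have sP i : 0 <= i -> forall z, cdiff T (i + 1) z = 0 -> cdiff T i (s i z) = z.
  exact: projT2 (boolp.cid (acyclic_above_splits CT acT i)).
have lp i : linear (fun x : T (i + 1) => x - s (i + 1) (cdiff T (i + 1) x)).
  by move=> a x y; rewrite (linearP (cdiff _ _)) (linearP (s _)) scalerBr opprD addrACA.
pose h i : {linear T (i + 1) -> T i} :=
  if 0 <= i then (s i \o mklin (lp i) : {linear T (i + 1) -> T i}) else \0.
have [g gE] := homotopy_perturb (Defs.cid T) h.
have hd i x : 0 <= i -> h i (cdiff T i x) = s i (cdiff T i x).
  by move=> i0; rewrite /h i0 /= cdiffK linear0 subr0.
have dh i x : 0 <= i -> cdiff T i (h i x) = x - s (i + 1) (cdiff T (i + 1) x).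
  move=> i0; rewrite /h i0 /= sP // linearB sP ?subrr ?cdiffK //.
  by rewrite addr_ge0.
have g_pos i x : 0 <= i -> g (i + 1) x = 0.
  move=> i0; have := gE i x; rewrite /= dh // hd ?addr_ge0 // subrK => e.
  by apply: oppr_inj; apply: (addrI x); rewrite oppr0 addr0.
have g_0 (x : T 0) : g 0 x = x - s 0 (cdiff T 0 x).
  have e : x - g 0 x = s 0 (cdiff T 0 x).
    rewrite -(hd 0 x isT) [LHS](gE (Negz 0) x).
    have e0 : cdiff T (Negz 0) (h (Negz 0) x) = 0 := linear0 _.
    by rewrite e0 add0r.
  by rewrite -e opprB addrC subrK.
have g_neg i x : i < 0 -> g i x = x.
  move=> i0; have [j e] : exists j, i = j + 1 by exists (i - 1); rewrite subrK.
  subst i; have := gE j x.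
  have j0 : j < 0 by apply: lt_trans i0; rewrite ltrDl.
  rewrite /h !leNgt i0 j0 /= linear0 addr0 => /eqP.
  by rewrite subr_eq0 => /eqP.
(* All of [T^i] for [i < 0], the cocycles for [i = 0], zero for [i > 0]: the image of the idempotent
   [g]. *)
pose U i (t : T i) := (0 <= i -> cdiff T i t = 0) /\ (0 < i -> t = 0).
have hU i : is_submodule (@U i).
  split=> [|a x y [x1 x2] [y1 y2]]; first by split=> _; rewrite ?linear0.
  split=> i0; first by rewrite linearP x1 // y1 // scaler0 addr0.
  by rewrite x2 // y2 // scaler0 addr0.
have dU i (x : sub (hU i)) : U (i + 1) ((cdiff T i \o sub_incl (hU i)) x).
  split=> i0; rewrite /= ?cdiffK //.
  by apply: (sub_valK x).1; rewrite -ltzD1.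
have ddU i (x : sub (hU i)) :
    corestr (hU (i + 1 + 1)) (dU (i + 1)) (corestr (hU (i + 1)) (dU i) x) = 0.
  by apply: sub_val_inj; rewrite /= cdiffK.
pose T' : complex R := Complex ddU.
have gU i x : U i (g i x).
  have [i0|i0|i0] := ltgtP i 0.
  - by split=> [/le_lt_trans/(_ i0)|/lt_trans/(_ i0)]; rewrite ltxx.
  - have [j e] : exists j, i = j + 1 by exists (i - 1); rewrite subrK.
    subst i; rewrite g_pos -?ltzD1 //; exact: submod0 (hU _).
  subst i; split=> // _; rewrite g_0 linearB sP ?subrr ?cdiffK //.
have gid i x : U i x -> g i x = x.
  move=> [x1 x2]; have [i0|i0|i0] := ltgtP i 0.
  - exact: g_neg.
  - by rewrite x2 // linear0.
  by subst i; rewrite g_0 x1 // linear0 subr0.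
have aE i x : corestr (hU (i + 1)) (gU (i + 1)) (cdiff T i x) =
    cdiff T' i (corestr (hU i) (gU i) x).
  by apply: sub_val_inj; rewrite /= cmorE.
have bE i (x : T' i) : sub_incl (hU (i + 1)) (cdiff T' i x) = cdiff T i (sub_incl (hU i) x).
  by [].
exists T'; split.
- split; last by exists 0 => i i0 x; apply: sub_val_inj; exact: (sub_valK x).2.
  move=> i; exact: (subcat_retract hCA hCfull hCkar (hU i) (CT.1 i) (gU i) (gid i)).
- by move=> i i0 x; apply: sub_val_inj; exact: (sub_valK x).2.
exists (@CMap R T T' _ aE), (@CMap R T' T _ bE); split.
  by exists (fun i => \- h i) => i x; rewrite /= linearN -opprD -gE opprB.
apply: homotopic_ext => i x; apply: sub_val_inj; apply: gid; exact: sub_valK.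
Qed.

End TruncationAbove.

(** * Injectives in the heart *)

Section Coreflection.

Context {R : pzRingType} (C : lmodType R -> Prop).
Implicit Types X Y Z S T : complex R.

(** The universal property of an approximation without the quasi-isomorphism; it suffices for
    representing functors on [H_C]. *)
Definition is_coreflection T S (q : cmap T S) : Prop :=
  Kminus C T /\ forall Z, Kminus C Z ->
    (forall f g : cmap Z T, homotopic (ccomp q f) (ccomp q g) -> homotopic f g) /\
    (forall g : cmap Z S, exists f : cmap Z T, homotopic (ccomp q f) g).

Lemma approximation_coreflection T S (q : cmap T S) :
  is_approximation C q -> is_coreflection q.
Proof. by case. Qed.

Lemma coreflection_equivalence T S S' (q : cmap T S) (a : cmap S S') (b : cmap S' S) :
  homotopic (ccomp b a) (Defs.cid S) -> homotopic (ccomp a b) (Defs.cid S') ->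
  is_coreflection q -> is_coreflection (ccomp a q).
Proof.
move=> ba ab [CT qP]; split=> // Z CZ; have [qi qs] := qP Z CZ; split.
  move=> f g fg; apply: qi.
  apply: homotopic_trans (homotopic_sym (homotopic_cancell _ ba)) _.
  apply: homotopic_trans (homotopic_cancell _ ba).
  apply: homotopic_compl; apply: homotopic_trans (ccompA _ _ _) _.
  by apply: homotopic_trans fg _; exact/homotopic_sym/ccompA.
move=> g; have [f fg] := qs (ccomp b g); exists f.
apply: homotopic_trans (homotopic_sym (ccompA _ _ _)) _.
by apply: homotopic_trans (homotopic_compl a fg) _; exact: homotopic_cancell.
Qed.

Lemma approximation_equivalence T' T S (q : cmap T S) (a : cmap T' T) (b : cmap T T') :
  homotopic (ccomp b a) (Defs.cid T') -> homotopic (ccomp a b) (Defs.cid T) ->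
  Kminus C T' -> is_approximation C q -> is_approximation C (ccomp q a).
Proof.
move=> ba ab CT' [CT qq qP]; split=> //.
  by apply: quasi_iso_comp qq; exact: quasi_iso_homotopy_equivalence ba ab.
move=> Z CZ; have [qi qs] := qP Z CZ; split=> [f g fg|g].
  apply: homotopic_trans (homotopic_sym (homotopic_cancell _ ba)) _.
  apply: homotopic_trans (homotopic_cancell _ ba).
  apply: homotopic_compl; apply: qi; apply: homotopic_trans (ccompA _ _ _) _.
  by apply: homotopic_trans fg _; exact/homotopic_sym/ccompA.
have [f fg] := qs g; exists (ccomp b f).
apply: homotopic_trans (homotopic_sym (ccompA _ _ _)) _.
by apply: homotopic_trans (homotopic_compl q (homotopic_cancell f ab)) _.
Qed.

End Coreflection.

Section Main.

Context {k : comPzRingType} {R : algType k} {E : lmodType k} {C : lmodType R -> Prop}.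
Implicit Types X Y Z S T I : complex R.
Implicit Types M N : lmodType R.

Hypotheses (hR : artin_algebra R) (hE : is_dualizing_module E)
  (hCA : forall M : lmodType R, C M -> finitely_generated M)
  (hCadd : additive_subcat C) (hCfull : strictly_full C) (hCkar : karoubi_closed C).

Local Notation J n := (@cogen k R E n : lmodType R).

Lemma homotopic_clin X Y (f g : cmap X Y) :
  homotopic (clin (- 1 : k) g f) (czero X Y) <-> homotopic f g.
Proof.
by split=> -[h hh]; exists h => i x; rewrite -hh /= /clin_fun scaleNr scale1r subr0
  scaleN1r; exact: addrC.
Qed.

Section SerreCoreflection.

Context m n (A : 'I_m -> 'I_n -> R) T (q : cmap T (@serre_complex k R E m n A)).
Hypothesis qP : is_coreflection C q.

(** Maps from [K^-(C)] to [T] are maps to the Serre complex. That complex is zero in positive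
    degrees, which gives [acyclic_above]; and for [Y] in degrees [<= 0] the shift [Y[1]] is zero in
    degree 0, so its maps to the Serre complex are null-homotopic. *)
Lemma coreflection_heart : heart C T.
Proof.
have [CT qC] := qP; split.
  apply: acyclic_above_Tle0 => // i i0 M p CM dp.
  have [Z [P [CZ Z0 dZ [iota PE]]]] := concentrated_cmap hCA hCfull hCkar CM dp.
  have [|h hE'] := (qC Z CZ).1 P (czero _ _).
    apply: homotopic_ext => j x; have [ej|/Z0 jx] := eqVneq j (i + 1).
      by apply: zero_at_complex; apply: serre_complex_zero; right; rewrite ej ltzD1.
    by rewrite (jx x) !linear0.
  exists (h i \o iota) => x; rewrite -PE -[LHS]subr0.
  by rewrite [LHS](hE' i (iota x)) dZ linear0 addr0.
apply: Tge0_intro => // Y f CY Y0; apply: (qC _ (Kminus_shift CY)).1.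
apply: (@serre_homotopic _ _ _ _ _ A _ _ _ \0) => x.
by rewrite (Y0 1 isT x) !linear0 addr0.
Qed.

Context M (g : 'I_n -> M) (gP : presents A g).

Definition coreflection_pairing X (f : cmap X T) (u : cmap (stalk M) X) : E :=
  serre_pairing g (ccomp q f) u.

Lemma coreflection_represents : represents (heart C) coreflection_pairing.
Proof.
have [H Hn] := serre_represents gP hE.
split=> [X CX|X Y v f u _ _]; last by [].
have [Hd Hl Hi Hf] := H X (heart_Le0 CX).
have [qi qs] := qP.2 X (heart_Kminus CX).
split=> [f|a f f' u|f f'|phi phiP]; first exact: Hd.
- rewrite /coreflection_pairing -Hl; apply: serre_pairing_homl => //.
  by apply: homotopic_ext => i x; rewrite /= /clin_fun linearP.
- split=> [ff u|ff]; last by apply: qi; apply/Hi.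
  by apply: serre_pairing_homl => //; exact: homotopic_compl.
have [f fE] := Hf phi phiP; have [f' ff'] := qs f.
by exists f' => u; rewrite -fE; exact: serre_pairing_homl.
Qed.

End SerreCoreflection.

(** * Monomorphisms from objects of [H_C] into Serre complexes *)

Section Embedding.

Context X (hX : heart C X) (X0 : le0 X).
Context m n (A : 'I_m -> 'I_n -> R) N (g : 'I_n -> N) (gP : presents A g).
Context (F : cmap X (@serre_complex k R E m n A)).

(* [F^{-1}] and [F^0] identify [X^{-1}] with the pullback of
   [J m -> J n <- X^0]. *)
Hypothesis F_pullback : forall (x : X 0) (phi : J m), F 0 x = nakayama A phi :> J n ->
  exists y : X (Negz 0), x = cdiff X (Negz 0) y /\ phi = F (Negz 0) y.
Hypothesis F_inj : forall y : X (Negz 0), F (Negz 0) y = 0 -> y = 0.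

Context M (e : {linear N -> M}).
Hypothesis e_approx : forall M' (t : {linear N -> M'}), C M' ->
  exists s : {linear M -> M'}, forall x, t x = s (e x).

(** Every map [N -> M'] factors through [e], so the hypothesis makes [F u] pair to zero with all of
    them, and [F u] is null-homotopic. The pullback property then lifts the homotopy [M' -> J m] to
    [X^-1], uniquely and hence linearly. *)
Lemma embedding_stalk M' (u : cmap (stalk M') X) : C M' ->
  (forall t : cmap (stalk M) (stalk M'),
     serre_pairing g F (ccomp (ccomp u t) (stalk_fun e)) = 0) ->
  exists h : {linear M' -> X (Negz 0)}, forall x : M', u 0 x = cdiff X (Negz 0) (h x).
Proof.
move=> CM' ut.
have : homotopic (ccomp F u) (czero _ _).
  apply: (serre_pairing_faithful_le0 gP hE) => [|c]; first exact: le0_stalk.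
  have [s sE] := e_approx (c 0 : {linear N -> M'}) CM'.
  transitivity (serre_pairing g F (ccomp (ccomp u (stalk_fun s)) (stalk_fun e))).
    by apply: eq_bigr => i _; rewrite [c 0 _]sE.
  by rewrite ut /serre_pairing /pairing big1.
move=> /homotopic_stalk[h hh].
have hP x : exists y, u 0 x = cdiff X (Negz 0) y /\ (h x : J m) = F (Negz 0) y.
  by apply: F_pullback; rewrite -[RHS](hh x) /= subr0.
have [y yP] := choice hP.
have ly : linear y.
  move=> a x z; apply/eqP; rewrite -subr_eq0; apply/eqP/F_inj.
  have [_ e1] := yP x; have [_ e2] := yP z; have [_ e3] := yP (a *: x + z).
  by rewrite linearB (linearP (F _)) -e1 -e2 -e3 (linearP h) subrr.
by exists (mklin ly) => x; have [] := yP x.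
Qed.

(** [f] represents the functional that restricts a map [P_M -> X] along [e] and pairs it with [F].
    If [f u] is null-homotopic, [embedding_stalk] makes [u^0] a boundary, and [Tge0_kill]
    finishes. *)
Lemma embedding_mono m0 n0 (A0 : 'I_m0 -> 'I_n0 -> R) (g0 : 'I_n0 -> M) :
  presents A0 g0 ->
  exists f : cmap X (@serre_complex k R E m0 n0 A0),
    forall Z (u : cmap Z X), heart C Z -> homotopic (ccomp f u) (czero _ _) ->
      homotopic u (czero _ _).
Proof.
move=> gP0.
have psiP := in_dual_hom_precomp (stalk_fun e) (serre_pairing_dual gP F).
have [f fE] := serre_pairing_full_le0 gP0 hE (@X0 1 isT) psiP.
exists f => Z u hZ fu.
have [Z' [hZ' Z'0 [c [c' [cc cc']]]]] := heart_le0_model hZ.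
have dZ (x : Z' 0) : cdiff Z' 0 (idfun x) = 0 by exact: (Z'0 1 isT).
(* The identity of [Z'^0] is a chain map from the stalk because [Z'^1 = 0]. *)
pose kappa := stalk_cmap dZ.
have CZ0 := (heart_Kminus hZ').1 0.
have [t|h hh] := @embedding_stalk (Z' 0) (ccomp (ccomp u c') kappa) CZ0.
  rewrite -[LHS](fE (ccomp (ccomp (ccomp u c') kappa) t)).
  have := serre_pairing_homl gP0 (ccomp c' (ccomp kappa t)) fu.
  move=> h; apply: etrans (etrans h _) => //.
  by rewrite /serre_pairing /pairing big1.
have /(homotopic_compr c) h0 := @Tge0_kill _ _ hCA hCfull hCkar _ Z'0 (heart_Kminus hZ') _
  (ccomp u c') h hX.2 hh.
apply: homotopic_trans (homotopic_sym (homotopic_cancel u cc)) _.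
by apply: homotopic_trans h0 _; exact: homotopic_ext.
Qed.

End Embedding.

(** [M] is found before its presentation and the coreflection are given, since these are supplied
    later, together with [serreC E C M]. *)
Lemma heart_embeds (W : complex R) : coapproximating C -> heart C W ->
  exists M, C M /\ forall m n (A : 'I_m -> 'I_n -> R) (g : 'I_n -> M) T
      (q : cmap T (@serre_complex k R E m n A)), presents A g -> is_coreflection C q ->
    exists f : cmap W T, forall Z (u : cmap Z W), heart C Z ->
      homotopic (ccomp f u) (czero _ _) -> homotopic u (czero _ _).
Proof.
move=> co hW; have [X [hX X0 [c [c' [cc cc']]]]] := heart_le0_model hW.
have Xfg i : finitely_generated (X i) by exact/hCA/(heart_Kminus hX).1.
have [m [iota iotaP]] := cogen_embed hR hE (Xfg (Negz 0)) (submod_zero _).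
have lj : linear (fun x : X (Negz 0) => (iota x, - cdiff X (Negz 0) x) : J m * X 0).
  move=> a x y; rewrite (linearP iota) (linearP (cdiff _ _)) opprD -scalerN.
  by [].
(* The kernel of [F] is the set of pairs [(iota y, - d y)], so [F] embeds the pushout into [J n]. *)
have [n [F FP]] := cogen_embed hR hE (fg_prod (cogen_fg hR hE m) (Xfg 0)) (submod_im (mklin lj)).
have lb : linear (fun phi : J m => F (phi, 0)).
  move=> a x y; rewrite -linearP; congr (F _).
  by rewrite /GRing.scale /GRing.add /= /scale_pair /add_pair /= scaler0 addr0.
have la : linear (fun x : X 0 => F (0, x)).
  move=> a x y; rewrite -linearP; congr (F _).
  by rewrite /GRing.scale /GRing.add /= /scale_pair /add_pair /= scaler0 addr0.
have Fsplit phi x : F (phi, - x) = F (phi, 0) - F (0, x).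
  by rewrite -linearB -[phi in LHS]subr0 -[- x]sub0r.
have [A AE] := cogen_hom hR hE (mklin lb).
have [|fN [fN0 fN1]] := @serre_cmap _ _ _ _ _ A X (mklin la) iota (@X0 1 isT).
  move=> x; rewrite -AE /=; apply/eqP; rewrite -subr_eq0 -Fsplit; apply/eqP/FP.
  by exists x.
have [N [g [Nfg gP]]] := presents_exists hR hE A.
have [M [e [CM e_approx]]] := left_approximation hCadd hCfull co Nfg.
exists M; split=> // m0 n0 A0 g0 T q gP0 qP.
have [||f fP] := embedding_mono hX X0 gP (F := fN) _ _ e_approx gP0.
(* Equal images of [x] and [phi] mean [F (phi, - x) = 0], so the pair is [(iota y, - d y)] for some
   [y]. *)
- move=> x phi; rewrite fN0 -AE => /esym/eqP; rewrite -subr_eq0 -Fsplit => /eqP/FP[y yE].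
  exists y; rewrite fN1; case: yE => -> /oppr_inj -> //.
- by move=> y; rewrite fN1 => /iotaP.
have [f' qf'] := (qP.2 X (heart_Kminus hX)).2 f.
exists (ccomp f' c) => Z u hZ fu.
have : homotopic (ccomp c u) (czero _ _).
  apply: fP hZ _.
  apply: homotopic_trans (homotopic_compr _ (homotopic_sym qf')) _.
  apply: homotopic_trans (homotopic_trans _ (homotopic_compl q fu)) _;
    apply: homotopic_ext => // i x.
  exact: linear0.
move=> /(homotopic_compl c') h0.
apply: homotopic_trans (homotopic_sym (homotopic_cancell u cc)) _.
apply: homotopic_trans h0 _; apply: homotopic_ext => i x; exact: linear0.
Qed.

Lemma mono_heart X T (f : cmap X T) :
  (forall Z (u : cmap Z X), heart C Z -> homotopic (ccomp f u) (czero _ _) ->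
    homotopic u (czero _ _)) -> mono_in (heart C) f.
Proof.
move=> fP Z u v hZ fuv; apply/homotopic_clin; apply: fP hZ _.
apply: homotopic_trans (proj2 (homotopic_clin _ _) fuv).
by apply: homotopic_ext => i x; rewrite /= /clin_fun linearP.
Qed.

Hypothesis hCfin : functorially_finite C.

Lemma serreC_spec M : C M ->
  exists m n (A : 'I_m -> 'I_n -> R) (g : 'I_n -> M)
    (q : cmap (serreC E C M) (@serre_complex k R E m n A)),
    [/\ presents A g, is_coreflection C q &
      exists q' : cmap (serreC E C M) (serreA E M), is_approximation C q'].
Proof.
move=> CM; have Mfg := hCA CM.
have [m [n [A [g gP]]]] := fg_presents hR hE Mfg.
have [a [b [ba ab]]] := serreA_equivalent hR hE Mfg gP.
have [[hS _] _] := serreA_spec hR hE Mfg.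
have [q' q'P] : exists q : cmap (serreC E C M) (serreA E M), is_approximation C q.
  apply: (ClassicalEpsilon.epsilon_spec (inhabits (stalk zero_module))
    (fun Y => exists q : cmap Y (serreA E M), is_approximation C q)).
  apply: hCfin.1; case: hS => Sfg S0 _; split=> //.
  by exists 0 => i i0; apply: S0; right.
exists m, n, A, g, (ccomp a q'); split=> //; last by exists q'.
exact: coreflection_equivalence ba ab (approximation_coreflection q'P).
Qed.

Lemma serreC_injective M : C M -> injective_in (heart C) (serreC E C M).
Proof.
move=> CM; have [m [n [A [g [q [gP qP _]]]]]] := serreC_spec CM.
apply: (represents_injective hE (coreflection_represents qP gP)).
  exact: coreflection_heart qP.
exact: heart_stalk.
Qed.

Lemma enough_injectives_heart : enough_injectives (heart C).
Proof.
move=> X hX; have [M [CM Memb]] := heart_embeds hCfin.2 hX.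
have [m [n [A [g [q [gP qP _]]]]]] := serreC_spec CM.
have [f fP] := Memb _ _ _ _ _ _ gP qP.
by exists (serreC E C M), f; split; [exact: serreC_injective | exact: mono_heart].
Qed.

Section Idempotent.

Context m n (A : 'I_m -> 'I_n -> R) M (CM : C M) (g : 'I_n -> M) (gP : presents A g).
Context T (q : cmap T (@serre_complex k R E m n A)) (qP : is_coreflection C q).

Let P (w : cmap (stalk M) T) : E := serre_pairing g q w.

(* Fullness of [M |-> T] on endomorphisms, by biduality for [End(M)]. *)
Lemma coreflection_full (e : cmap T T) :
  exists eps : {linear M -> M}, forall w, P (ccomp e w) = P (ccomp w (stalk_fun eps)).
Proof.
have Mfg := hCA CM; have KM := Kminus_stalk hCadd hCfull CM.
have [qi qs] := qP.2 _ KM.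
(* Each [F : M -> J n] is a chain map from [P_M] to the Serre complex and lifts to [T]; thus [e]
   induces a functional of [F], to which biduality applies. *)
pose sF (F : {linear M -> J n}) : cmap (stalk M) (serre_complex A) :=
  @stalk_cmap _ M (serre_complex A) F (fun _ => erefl).
have /choice[u uP] : forall F, exists u, homotopic (ccomp q u) (sF F) by move=> F; exact: qs.
have [a F G H HE|eps epsP] :=
    pairing_bidual hR hE gP (Phi := fun F => P (ccomp e (u F))) Mfg.
  have dP := serre_pairing_dual gP (ccomp q e).
  apply: (in_dual_hom_scale dP); apply: qi.
  apply: homotopic_trans (uP H) _.
  have h1 : homotopic (ccomp q (clin a (u F) (u G))) (clin a (ccomp q (u F)) (ccomp q (u G))).
    by apply: homotopic_ext => i x; rewrite /= /clin_fun linearP.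
  apply: homotopic_sym; apply: homotopic_trans h1 _.
  apply: (serre_pairing_faithful_le0 gP hE) => [|c]; first exact: le0_stalk.
  rewrite serre_pairing_linl (serre_pairing_homl gP c (uP F)) (serre_pairing_homl gP c (uP G)).
  exact: esym (HE (c 0)).
exists eps => w.
pose F : {linear M -> J n} := ccomp q w 0.
have uw : homotopic (u F) w.
  by apply: qi; apply: homotopic_trans (uP F) _; exact: homotopic_stalk0.
rewrite -[RHS](epsP F); apply: serre_pairing_homr => //.
exact: homotopic_compl (homotopic_sym uw).
Qed.

Lemma coreflection_faithful (u v : {linear M -> M}) :
  (forall w, P (ccomp w (stalk_fun u)) = P (ccomp w (stalk_fun v))) -> forall x, u x = v x.
Proof.
move=> uv; have Mfg := hCA CM; have KM := Kminus_stalk hCadd hCfull CM.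
apply: (pairing_separates hR hE gP) => F.
have [w qw] := (qP.2 _ KM).2 (@stalk_cmap _ M (serre_complex A) F (fun _ => erefl)).
have h (c : {linear M -> M}) : pairing g F c = P (ccomp w (stalk_fun c)).
  exact: esym (serre_pairing_homl gP (stalk_fun c) qw).
by rewrite !h.
Qed.

End Idempotent.

Lemma injective_serreC I : injective_in (heart C) I ->
  exists M, C M /\ homotopy_equivalent I (serreC E C M).
Proof.
move=> [hI Iinj]; have [M [CM Memb]] := heart_embeds hCfin.2 hI.
have [m [n [A [g [q [gP qP _]]]]]] := serreC_spec CM.
have [i /mono_heart imono] := Memb _ _ _ _ _ _ gP qP.
set T := serreC E C M in q qP i imono.
have hT : heart C T := coreflection_heart qP.
have [r ri] := Iinj I T i (Defs.cid I) hI hT imono.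
pose e := ccomp i r.
have [eps epsP] := coreflection_full CM gP qP e.
pose P w := serre_pairing g q w.
have Phom w w' : homotopic w w' -> P w = P w' by exact: serre_pairing_homr.
have ei : homotopic (ccomp e i) i.
  apply: homotopic_trans (homotopic_sym (ccompA _ _ _)) _; exact: homotopic_idr.
have ee : homotopic (ccomp e e) e.
  apply: homotopic_trans (ccompA _ _ _) _; exact: homotopic_compr ei.
have eps2 x : eps (eps x) = eps x.
  apply: (coreflection_faithful CM gP qP (u := eps \o eps)) => w.
  transitivity (P (ccomp e (ccomp w (stalk_fun eps)))).
    exact: esym (epsP (ccomp w (stalk_fun eps))).
  transitivity (P (ccomp e (ccomp e w))); first exact: esym (epsP (ccomp e w)).
  transitivity (P (ccomp e w)); last exact: epsP.
  by apply: Phom; apply: homotopic_trans (ccompA _ _ _) _; exact: homotopic_compr ee.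
pose U x := eps x = x.
have hU : is_submodule U.
  by split=> [|a x y Ux Uy]; rewrite /U ?linear0 // linearP Ux Uy.
pose iota := sub_incl hU.
pose rho := corestr hU eps2.
have rhoK (x : sub hU) : rho (eps (iota x)) = x.
  by apply: sub_val_inj; rewrite /= !(sub_valK x).
have CM1 : C (sub hU) by exact: (subcat_retract hCA hCfull hCkar hU CM eps2).
have [m1 [n1 [A1 [g1 [q1 [gP1 qP1 _]]]]]] := serreC_spec CM1.
set T1 := serreC E C (sub hU) in q1 qP1 *.
have hT1 : heart C T1 := coreflection_heart qP1.
exists (sub hU); split=> //.
pose P1 w := serre_pairing g1 q1 w.
have H := coreflection_represents qP gP; have H1 := coreflection_represents qP1 gP1.
(* [b' : T1 -> T] corresponds to restriction along [iota], and [a : I -> T1] to [i] followed by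
   restriction along [rho]. *)
have [b' b'P] := represents_full H hT1
  (in_dual_hom_precomp (stalk_fun iota) (serre_pairing_dual gP1 q1)).
have [a aP] := represents_full H1 hI
  (in_dual_hom_precomp (stalk_fun rho) (serre_pairing_dual gP (ccomp q i))).
exists a, (ccomp r b'); split; last first.
  apply: (represents_inj H1 hT1) => w.
  transitivity (P (ccomp e (ccomp (ccomp b' w) (stalk_fun rho)))).
    exact: aP (ccomp (ccomp r b') w).
  rewrite [LHS]epsP.
  transitivity (P1 (ccomp w (stalk_fun (rho \o eps \o iota)))).
    exact: b'P (ccomp w (stalk_fun (rho \o eps))).
  apply: eq_bigr => j _.
  exact: (congr1 (fun x => @cfun k R E n1 (q1 0 (w 0 x)) (evec j)) (rhoK (g1 j))).
(* The identity on [I] is tested after the monomorphism [i], where [i r] is [e] and can be traded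
   for [eps] on [M]. *)
apply: (imono _ _ _ hI); apply: (represents_inj H hI) => u.
transitivity (P (ccomp e (ccomp b' (ccomp a u)))); first by [].
rewrite [LHS]epsP.
transitivity (P1 (ccomp a (ccomp u (stalk_fun (eps \o iota))))).
  exact: b'P (ccomp (ccomp a u) (stalk_fun eps)).
transitivity (P (ccomp i (ccomp u (stalk_fun (eps \o iota \o rho))))).
  exact: aP (ccomp u (stalk_fun (eps \o iota))).
transitivity (P (ccomp (ccomp i u) (stalk_fun eps))).
  apply: eq_bigr => j _.
  exact: (congr1 (fun x => @cfun k R E n (q 0 (i 0 (u 0 x))) (evec j)) (eps2 (g j))).
transitivity (P (ccomp e (ccomp i u))); first exact: esym (epsP (ccomp i u)).
transitivity (P (ccomp i u)) => //; apply: Phom.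
by apply: homotopic_trans (ccompA _ _ _) _; exact: homotopic_compr ei.
Qed.

End Main.

Theorem proposition4p3 (k : comPzRingType) (R : algType k) (E : lmodType k)
    (C : lmodType R -> Prop)
    (hR : artin_algebra R)
    (hE : is_dualizing_module E)
    (hCA : forall M : lmodType R, C M -> finitely_generated M)
    (hCadd : additive_subcat C)
    (hCfull : strictly_full C)
    (hCkar : karoubi_closed C)
    (hCfin : functorially_finite C) :
  [/\ enough_injectives (heart C),
      forall M : lmodType R, C M -> injective_in (heart C) (serreC E C M),
      forall I : complex R, injective_in (heart C) I ->
        exists M : lmodType R, C M /\ homotopy_equivalent I (serreC E C M) &
      forall I : complex R, injective_in (heart C) I ->
        exists (J : complex R) (q : cmap I J),
          injective_in heartA J /\ is_approximation C q].
Proof.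
split.
- exact: (enough_injectives_heart hR hE hCA hCadd hCfull hCkar hCfin).
- by move=> M CM; exact: (serreC_injective hR hE hCA hCadd hCfull hCkar hCfin CM).
- by move=> I hI; exact: (injective_serreC hR hE hCA hCadd hCfull hCkar hCfin hI).
move=> I hI.
have [M [CM [a [b [ba ab]]]]] := injective_serreC hR hE hCA hCadd hCfull hCkar hCfin hI.
have [_ [_ [_ [_ [_ [_ _ [q qP]]]]]]] := serreC_spec hR hE hCA hCfin CM.
exists (serreA E M), (ccomp q a); split.
  by have [] := serreA_spec hR hE (hCA M CM).
exact: approximation_equivalence ba ab (heart_Kminus hI.1) qP.
Qed.
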